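(* \textsc{Temporal Cluster Editing} (TCE) can be solved in $O(\ell\cdot n^{4k+2}\log n)$ time, where $n=|V|$ is the number of vertices, $\ell$ the number of layers and $k$ the allowed number of edits per layer.
   Context: A temporal graph is a sequence $(G_i)_{i\in[\ell]}$ of graphs $G_i=(V,E_i)$ on the same vertex set $V$. An edit for a graph $G=(V,E)$ is an unordered pair of vertices of $V$. A set $M$ of edits is a cluster editing set for $G$ if $(V,E\oplus M)$ is a cluster graph, i.e. a disjoint union of cliques ($\oplus$ is symmetric difference). A clustering is a sequence $(M_i)_{i\in[\ell]}$ with $M_i$ a cluster editing set for $G_i$; it is $k$-bounded if $|M_i|\le k$ for all $i$. Writing $G_i'=(V,E_i\oplus M_i)$, the clustering is temporally $d$-consistent if there are sets $D_1,\dots,D_{\ell-1}\subseteq V$, each of size at most $d$, such that $G_i'[V\setminus D_i]=G_{i+1}'[V\setminus D_i]$ for every $i\in[\ell-1]$. TCE: given a temporal graph and integers $k,d$, decide whether there is a temporally $d$-consistent $k$-bounded clustering. *)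

(* Defs.v *)
From mathcomp Require Import all_boot.

Set Implicit Arguments.
Unset Strict Implicit.
Unset Printing Implicit Defensive.

Section Graphs.
Variable V : finType.

Definition pairs : {set {set V}} := [set e : {set V} | #|e| == 2].

Record graph := Graph {
  edges : {set {set V}};
  edges_pairs : edges \subset pairs }.

Definition clique (B : {set V}) : {set {set V}} :=
  [set e in pairs | e \subset B].

Definition cluster_graph (E : {set {set V}}) : Prop :=
  exists2 P : {set {set V}},
    partition P [set: V] & E = \bigcup_(B in P) clique B.

Definition symdiff (E M : {set {set V}}) : {set {set V}} :=
  (E :\: M) :|: (M :\: E).

Definition cluster_editing_set (G : graph) (M : {set {set V}}) : Prop :=
  M \subset pairs /\ cluster_graph (symdiff (edges G) M).

(* The edge set of the subgraph induced by W; its vertex set is W. *)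
Definition induced (E : {set {set V}}) (W : {set V}) : {set {set V}} :=
  [set e in E | e \subset W].

Definition temporal_graph (l : nat) := 'I_l -> graph.

Section Clusterings.
Variables (l : nat) (G : temporal_graph l) (M : 'I_l -> {set {set V}}).

Definition clustering : Prop := forall i, cluster_editing_set (G i) (M i).

Definition bounded (k : nat) : Prop := forall i, #|M i| <= k.

Definition temporally_consistent (d : nat) : Prop :=
  exists2 D : 'I_l.-1 -> {set V}, forall i, #|D i| <= d &
    forall (i : 'I_l.-1) (j j' : 'I_l), j = i :> nat -> j' = i.+1 :> nat ->
      induced (symdiff (edges (G j)) (M j)) (~: D i) =
      induced (symdiff (edges (G j')) (M j')) (~: D i).

End Clusterings.

Definition TCE (l : nat) (G : temporal_graph l) (k d : nat) : Prop :=
  exists M : 'I_l -> {set {set V}},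
    [/\ clustering G M, bounded M k & temporally_consistent G M d].

End Graphs.

(* Running time is measured on a random access machine under the uniform cost
   criterion.  The instruction set is that of Cook and Reckhow (addition and
   truncated subtraction only: without multiplication a step at most doubles
   the largest number, so that unit costs are realistic), with if and while in
   place of jumps, which changes running times only by a constant factor
   depending on the program.  A program is a finite term, hence uses finitely
   many registers and is independent of the instance. *)
Inductive prog :=
| Skip
| Const of nat & nat
| Add of nat & nat & nat
| Sub of nat & nat & nat
| Read of nat & nat
| Write of nat & nat
| Seq of prog & prog
| If of nat & prog & prog
| While of nat & prog.

Record state := State { reg : nat -> nat; mem : nat -> nat }.

Definition upd (f : nat -> nat) (x v : nat) : nat -> nat :=
  fun y => if y == x then v else f y.

Definition set_reg (s : state) (x v : nat) := State (upd (reg s) x v) (mem s).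
Definition set_mem (s : state) (a v : nat) := State (reg s) (upd (mem s) a v).

(* exec p s t s': started in s, p halts in s' after exactly t steps. *)
Inductive exec : prog -> state -> nat -> state -> Prop :=
| exec_skip s : exec Skip s 1 s
| exec_const s x c : exec (Const x c) s 1 (set_reg s x c)
| exec_add s x y z : exec (Add x y z) s 1 (set_reg s x (reg s y + reg s z))
| exec_sub s x y z : exec (Sub x y z) s 1 (set_reg s x (reg s y - reg s z))
| exec_read s x y : exec (Read x y) s 1 (set_reg s x (mem s (reg s y)))
| exec_write s x y : exec (Write x y) s 1 (set_mem s (reg s x) (reg s y))
| exec_seq p q s s' s'' t t' :
    exec p s t s' -> exec q s' t' s'' -> exec (Seq p q) s (t + t') s''
| exec_if_true x p q s s' t :
    reg s x != 0 -> exec p s t s' -> exec (If x p q) s t.+1 s'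
| exec_if_false x p q s s' t :
    reg s x = 0 -> exec q s t s' -> exec (If x p q) s t.+1 s'
| exec_while_end x p s : reg s x = 0 -> exec (While x p) s 1 s
| exec_while_loop x p s s' s'' t t' :
    reg s x != 0 -> exec p s t s' -> exec (While x p) s' t' s'' ->
    exec (While x p) s (t + t').+1 s''.

Lemma exec_det p s t s1 t' s2 :
  exec p s t s1 -> exec p s t' s2 -> t = t' /\ s1 = s2.
Proof.
move=> H; elim: H t' s2 => {p s t s1} *;
  match goal with E : exec _ _ ?t _ |- _ = ?t /\ _ => inversion E; subst end;
  repeat match goal with
    | IH : forall t s, exec ?p ?u t s -> _, E : exec ?p ?u _ _ |- _ =>
      case: (IH _ _ E) => ? ?; subst; clear E
    | N : is_true (reg ?s ?x != 0), Z : reg ?s ?x = 0 |- _ => by rewrite Z in N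
    end; by [].
Qed.

(* Registers 0 to 3 hold n, l, k and d; the memory holds the l adjacency
   matrices one after the other, each in row-major order.  All other registers
   and cells are 0. *)
Definition tce_input (n l : nat) (G : temporal_graph 'I_n l) (k d : nat) :
    state :=
  State
    (nth 0 [:: n; l; k; d])
    (fun a => [exists i : 'I_l, exists u : 'I_n, exists v : 'I_n,
       (a == (i * n + u) * n + v) && ([set u; v] \in edges (G i))]).

Definition accepting (s : state) : Prop := reg s 0 != 0.

(* Main.v *)
(* The cluster editing sets of a layer are found by enumerating all sequences of
   K = min(k, n^2) ordered pairs of vertices: the pair (u, u) stands for no edit,
   and a pair occurring twice cancels out.  There are n^(2K) such sequences, the
   digits in base n of the numbers below n^(2K).  Layer by layer, the program
   keeps those candidates that are cluster graphs and compatible with one kept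
   for the previous layer, so that at most n^(4K) compatibility tests are made
   per layer, and it remains to perform each of them in time O(n^2).

   Let a and b label the vertices by their clusters in two cluster graphs.  The
   graphs agree outside D iff the classes of (a, b) that meet the complement of D
   form a matching in the bipartite graph with an edge from a(v) to b(v) for each
   vertex v, so a smallest D is the complement of a maximum weight matching, the
   weight of an edge being the number of vertices it comes from.  The Hungarian
   method finds one in time O(n^2): there are n edges, and with all left
   potentials equal to n at the start, each O(n) search either enlarges the
   matching or lowers the common potential of the free left vertices by one,
   which happens at most n times each.  At level 0 the matching is optimal. *)

Require Import Defs.
From mathcomp Require Import all_boot zify.

Set Implicit Arguments.
Unset Strict Implicit.
Unset Printing Implicit Defensive.

(** * A loop language compiled to the random access machine *)

(** The time bound concerns a concrete machine program, so the program is written in a language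
    where a running time can be read off the text: all loops are counted, and their bounds are
    registers that stay fixed. Hence searching, tracing a path and running phases are not loops that
    stop when done: each repeats a small block exactly 2n times, a finished block idles, and a count
    of useful steps replaces a termination argument.

    The machine cannot multiply, so n^2, n^(2K) and the row offsets of the matrices are prepared by
    repeated addition, and the sequences are enumerated by incrementing an array of digits. The cap
    K <= n^2 loses no edit set, as there are at most n^2 pairs, and it keeps the cost of applying
    one sequence to a layer in O(n^2). *)

Local Notation cells := Defs.mem.

Inductive expr :=
| ECst of nat
| EReg of nat
| EArr of nat & expr
| EInp of expr
| EAdd of expr & expr
| ESub of expr & expr.

(** Arrays are named and cannot alias, so that what a command leaves alone is visible in its
    text. *)
Inductive cmd :=
| CSkip
| CReg of nat & expr
| CArr of nat & expr & expr
| CSeq of cmd & cmd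
| CIf of expr & cmd & cmd
| CFor of nat & nat & cmd.

Record mach := Mach { rv : nat -> nat; av : nat -> nat -> nat }.

Definition setr h x v := Mach (fun y => if y == x then v else rv h y) (av h).
Definition seta h a i v :=
  Mach (rv h) (fun b => if b == a then upd (av h a) i v else av h b).
Arguments setr : simpl never.
Arguments seta : simpl never.

Section Language.

(* The register holding the address of the first cell behind the input, and
   the contents of the input cells. *)
Variables (B : nat) (inp : nat -> nat).

Fixpoint eval (e : expr) (h : mach) : nat :=
  match e with
  | ECst c => c
  | EReg x => rv h x
  | EArr a e => av h a (eval e h)
  | EInp e => inp (eval e h)
  | EAdd e1 e2 => eval e1 h + eval e2 h
  | ESub e1 e2 => eval e1 h - eval e2 h
  end.

Fixpoint run (c : cmd) (h : mach) : mach :=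
  match c with
  | CSkip => h
  | CReg x e => setr h x (eval e h)
  | CArr a e1 e2 => seta h a (eval e1 h) (eval e2 h)
  | CSeq c1 c2 => run c2 (run c1 h)
  | CIf e c1 c2 => if eval e h != 0 then run c1 h else run c2 h
  | CFor x y c =>
      iter (rv h y) (fun h => let h' := run c h in setr h' x (rv h' x).+1)
        (setr h x 0)
  end.

Fixpoint regs_mod (c : cmd) : seq nat :=
  match c with
  | CReg x _ => [:: x]
  | CSeq c1 c2 | CIf _ c1 c2 => regs_mod c1 ++ regs_mod c2
  | CFor x _ c => x :: regs_mod c
  | _ => [::]
  end.

Fixpoint arrs_mod (c : cmd) : seq nat :=
  match c with
  | CArr a _ _ => [:: a]
  | CSeq c1 c2 | CIf _ c1 c2 => arrs_mod c1 ++ arrs_mod c2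
  | CFor _ _ c => arrs_mod c
  | _ => [::]
  end.

Fixpoint bounds (c : cmd) : seq nat :=
  match c with
  | CSeq c1 c2 | CIf _ c1 c2 => bounds c1 ++ bounds c2
  | CFor _ y c => y :: bounds c
  | _ => [::]
  end.

Definition frame (R A : seq nat) (h h' : mach) :=
  (forall x, x \notin R -> rv h' x = rv h x) /\
  (forall a, a \notin A -> av h' a = av h a).

Lemma frame_run c h : frame (regs_mod c) (arrs_mod c) h (run c h).
Proof.
elim: c h => [|x e|a e1 e2|c1 IH1 c2 IH2|e c1 IH1 c2 IH2|x y c IH] h //=.
- by split=> // z; rewrite inE /= => /negPf->.
- by split=> // b; rewrite inE /= => /negPf->.
- have [R1 A1] := IH1 h; have [R2 A2] := IH2 (run c1 h).
  by split=> z; rewrite mem_cat => /norP[z1 z2];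
    rewrite ?R2 ?A2 // ?R1 ?A1.
- have [R1 A1] := IH1 h; have [R2 A2] := IH2 h.
  by split=> z; rewrite mem_cat => /norP[z1 z2]; case: ifP;
    rewrite ?R2 ?A2 // ?R1 ?A1.
- elim: (rv h y) => [|N [IHR IHA]] /=.
    by split=> // z; rewrite inE /= => /norP[/negPf->].
  set h1 := iter N _ _ in IHR IHA *; have [R1 A1] := IH h1.
  split=> [z zR|a aA] /=; last by rewrite /= A1 // IHA.
  by rewrite /=; move: (zR); rewrite inE => /norP[/negPf-> zc];
    rewrite R1 // IHR.
Qed.

(** The compiled loop compares counter and bound afresh in each round; it agrees with [iter] because
    the body touches neither. *)
Definition for_ok x y c :=
  [&& x != y, x \notin regs_mod c & y \notin regs_mod c].

(** Hoare rule for loops. The frame comes for free from the syntax, so an invariant has to mention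
    only what the loop changes. *)
Lemma run_for (I : nat -> mach -> Prop) x y c h :
  for_ok x y c ->
  I 0 (setr h x 0) ->
  (forall i g, frame (x :: regs_mod c) (arrs_mod c) h g ->
     i < rv h y -> rv g x = i -> I i g -> I i.+1 (setr (run c g) x i.+1)) ->
  I (rv h y) (run (CFor x y c) h).
Proof.
move=> /and3P[xy xc yc] I0 IS /=.
suff: forall i, i <= rv h y ->
  let g := iter i (fun h => let h' := run c h in setr h' x (rv h' x).+1)
        (setr h x 0) in
  [/\ frame (x :: regs_mod c) (arrs_mod c) h g, rv g x = i & I i g].
  by case/(_ _ (leqnn _)).
elim=> [|i IH] lti /=.
  split=> //; last by rewrite /= eqxx.
  by split=> // z; rewrite inE /= => /norP[/negPf->].
have [] := IH (ltnW lti); set g := iter i _ _ => -[RF AF] gx Ig.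
have [R1 A1] := frame_run c g.
rewrite /= eqxx R1 // gx; split=> //; last by apply: IS.
split=> [z zR|a aA]; last by rewrite /= A1 // AF.
by rewrite /=; move: (zR); rewrite inE => /norP[/negPf-> zc];
  rewrite R1 // RF.
Qed.

Fixpoint wf_expr (e : expr) : bool :=
  match e with
  | ECst _ => true
  | EReg x => x < B
  | EArr a e => (a < 16) && wf_expr e
  | EInp e => wf_expr e
  | EAdd e1 e2 | ESub e1 e2 => wf_expr e1 && wf_expr e2
  end.

(* Registers bounding a loop may be modified neither before nor inside it, so
   that [time_bound] can read them in the initial state. *)
Fixpoint wf_cmd (c : cmd) : bool :=
  match c with
  | CSkip => true
  | CReg x e => (x < B) && wf_expr e
  | CArr a e1 e2 => [&& a < 16, wf_expr e1 & wf_expr e2]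
  | CSeq c1 c2 => [&& wf_cmd c1, wf_cmd c2 & ~~ has (mem (regs_mod c1)) (bounds c2)]
  | CIf e c1 c2 => [&& wf_expr e, wf_cmd c1 & wf_cmd c2]
  | CFor x y c => [&& x < B, y < B, for_ok x y c, wf_cmd c &
                     ~~ has (mem (x :: regs_mod c)) (bounds c)]
  end.

(* The array [a] occupies every 16th cell: its entry [i] is stored at address
   [reg B + (16 * i + a)]. *)
Definition address a t : prog :=
  Seq (Add t t t) (Seq (Add t t t) (Seq (Add t t t) (Seq (Add t t t)
    (Seq (Add t t B) (Seq (Const t.+1 a) (Add t t t.+1)))))).

(** Registers from [t] upwards serve as evaluation stack, with the result in [t]. Reads of the input
    are guarded by the base address, because the cells behind the input hold the arrays. *)
Fixpoint cexpr (e : expr) (t : nat) : prog :=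
  match e with
  | ECst c => Const t c
  | EReg x => Seq (Const t 0) (Add t x t)
  | EArr a e => Seq (cexpr e t) (Seq (address a t) (Read t t))
  | EInp e => Seq (cexpr e t) (Seq (Defs.Sub t.+1 B t)
                (If t.+1 (Read t t) (Const t 0)))
  | EAdd e1 e2 => Seq (cexpr e1 t) (Seq (cexpr e2 t.+1) (Add t t t.+1))
  | ESub e1 e2 => Seq (cexpr e1 t) (Seq (cexpr e2 t.+1) (Defs.Sub t t t.+1))
  end.

Fixpoint time_expr (e : expr) : nat :=
  match e with
  | ECst _ => 1
  | EReg _ => 2
  | EArr _ e => time_expr e + 8
  | EInp e => time_expr e + 3
  | EAdd e1 e2 | ESub e1 e2 => time_expr e1 + time_expr e2 + 1
  end.

Fixpoint ccmd (c : cmd) : prog :=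
  match c with
  | CSkip => Skip
  | CReg x e => Seq (cexpr e B.+1) (Seq (Const B.+2 0) (Add x B.+1 B.+2))
  | CArr a e1 e2 => Seq (cexpr e1 B.+1) (Seq (address a B.+1)
                      (Seq (cexpr e2 B.+2) (Write B.+1 B.+2)))
  | CSeq c1 c2 => Seq (ccmd c1) (ccmd c2)
  | CIf e c1 c2 => Seq (cexpr e B.+1) (If B.+1 (ccmd c1) (ccmd c2))
  | CFor x y c =>
      Seq (Const x 0) (Seq (Defs.Sub B.+1 y x) (While B.+1
        (Seq (ccmd c) (Seq (Const B.+1 1)
          (Seq (Add x x B.+1) (Defs.Sub B.+1 y x))))))
  end.

(** Charging both branches of a conditional keeps the bound independent of all data except the loop
    bounds. *)
Fixpoint time_bound (c : cmd) (h : mach) : nat :=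
  match c with
  | CSkip => 1
  | CReg _ e => time_expr e + 2
  | CArr _ e1 e2 => time_expr e1 + time_expr e2 + 8
  | CSeq c1 c2 => time_bound c1 h + time_bound c2 h
  | CIf e c1 c2 => time_expr e + (time_bound c1 h + time_bound c2 h) + 1
  | CFor _ y c => rv h y * (time_bound c h + 4) + 3
  end.

Lemma time_bound_ext c h h' :
  {in bounds c, rv h =1 rv h'} -> time_bound c h = time_bound c h'.
Proof.
elim: c => [|x e|a e1 e2|c1 IH1 c2 IH2|e c1 IH1 c2 IH2|x y c IH] //= E.
- by rewrite IH1 ?IH2 // => x xc; apply: E; rewrite mem_cat xc ?orbT.
- by rewrite IH1 ?IH2 // => x xc; apply: E; rewrite mem_cat xc ?orbT.
- by rewrite IH ?E ?mem_head // => z zc; apply: E; rewrite inE zc orbT.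
Qed.

(** Register [B] and those above it are hidden from the loop language. The second and third clauses
    together make a guarded read return [inp] at every address. *)
Definition rep (s : state) (h : mach) : Prop :=
  [/\ forall x, x < B -> reg s x = rv h x,
      forall a, cells s a = inp a \/ reg s B <= a,
      forall a, reg s B <= a -> inp a = 0 &
      forall a i, a < 16 -> cells s (reg s B + (16 * i + a)) = av h a i].

Lemma exec_address s a t : B < t ->
  exists2 s', exec (address a t) s 7 s' &
    [/\ cells s' = cells s, reg s' t = reg s B + (16 * reg s t + a) &
        forall x, x < t -> reg s' x = reg s x].
Proof.
move=> Bt; eexists.
  by do 6![rewrite -[7]/(1 + _) || idtac; apply: (@exec_seq _ _ _ _ _ 1 _);
     first by constructor]; constructor.
split=> //= [|x xt]; last by rewrite /upd !ifN ?neq_ltn ?xt // ltnS ltnW.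
have t1 : t == t.+1 = false by rewrite ltn_eqF.
rewrite /upd !eqxx ?t1 ?(ltn_eqF Bt) ?(ltn_eqF (ltnW Bt : B < t.+1)).
lia.
Qed.

Lemma exec_cexpr e t s h : rep s h -> wf_expr e -> B < t ->
  exists2 s', exec (cexpr e t) s (time_expr e) s' &
    [/\ cells s' = cells s, reg s' t = eval e h &
        forall x, x < t -> reg s' x = reg s x].
Proof.
(* Sums and differences differ only in the last instruction, so one claim about [op] and [f] covers
   both. *)
move=> hs we Bt; have bin op f e1 e2 :
  (forall s x y z, exec (op x y z) s 1 (set_reg s x (f (reg s y) (reg s z)))) ->
  (forall t s, rep s h -> wf_expr e1 -> B < t ->
     exists2 s', exec (cexpr e1 t) s (time_expr e1) s' &
    [/\ cells s' = cells s, reg s' t = eval e1 h &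
        forall x, x < t -> reg s' x = reg s x]) ->
  (forall t s, rep s h -> wf_expr e2 -> B < t ->
     exists2 s', exec (cexpr e2 t) s (time_expr e2) s' &
    [/\ cells s' = cells s, reg s' t = eval e2 h &
        forall x, x < t -> reg s' x = reg s x]) ->
  forall t s, rep s h -> wf_expr e1 && wf_expr e2 -> B < t ->
  exists2 s', exec (Seq (cexpr e1 t) (Seq (cexpr e2 t.+1) (op t t t.+1)))
    s (time_expr e1 + time_expr e2 + 1) s' &
    [/\ cells s' = cells s, reg s' t = f (eval e1 h) (eval e2 h) &
        forall x, x < t -> reg s' x = reg s x].
  move=> Hop IH1 IH2 {}t {}s {}hs /andP[w1 w2] {}Bt.
  have [s1 E1 [M1 V1 F1]] := IH1 _ _ hs w1 Bt.
  have hs1 : rep s1 h.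
    case: hs => [H1 H2 H3 H4]; split; rewrite ?M1 ?F1 // => x xB.
    by rewrite F1 ?H1 // (ltn_trans xB).
  have [s2 E2 [M2 V2 F2]] := IH2 _ _ hs1 w2 (ltnW Bt : B < t.+1).
  exists (set_reg s2 t (f (reg s2 t) (reg s2 t.+1))).
    rewrite -addnA; apply: exec_seq E1 _; apply: exec_seq E2 _; exact: Hop.
  split=> //=; first by rewrite M2.
    by rewrite /upd eqxx V2 F2 // V1.
  by move=> x xt; rewrite /upd ltn_eqF // F2 ?F1 // ltnS ltnW.
elim: e t s hs we Bt => [c|x|a e IH|e IH|e1 IH1 e2 IH2|e1 IH1 e2 IH2]
  t s hs /= we Bt.
- eexists; first by constructor.
  by split=> //= [|x xt]; rewrite /upd ?eqxx // ltn_eqF.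
- eexists.
    by apply: (@exec_seq _ _ _ _ _ 1 1); constructor.
  split=> //= [|z zt]; rewrite /upd ?eqxx; last by rewrite !ltn_eqF.
  rewrite ltn_eqF ?(ltn_trans we Bt) // addn0.
  by case: hs => H1 _ _ _; rewrite H1.
- case/andP: we => a16 we; have [s1 E1 [M1 V1 F1]] := IH _ _ hs we Bt.
  have [s2 E2 [M2 V2 F2]] := @exec_address s1 a t Bt.
  eexists.
    apply: exec_seq E1 _; rewrite -[8]/(7 + 1); apply: exec_seq E2 _.
    by constructor.
  split=> //= [||x xt]; first by rewrite M2.
    rewrite /upd eqxx M2 M1 V2 V1 F1 //.
    by case: hs => _ _ _ ->.
  by rewrite /upd ltn_eqF // F2 ?F1.
- have [s1 E1 [M1 V1 F1]] := IH _ _ hs we Bt.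
  have [_ H2 H3 _] := hs.
  have [lt|ge] := boolP (reg s B - eval e h != 0).
    exists (set_reg (set_reg s1 t.+1 (reg s1 B - reg s1 t)) t (inp (eval e h))).
      rewrite -[3]/(1 + 2); apply: exec_seq E1 _; apply: exec_seq; first by constructor.
      apply: exec_if_true; first by rewrite /= /upd eqxx F1 // V1.
      set s2 := set_reg s1 _ _.
      have ->: inp (eval e h) = cells s2 (reg s2 t).
        rewrite /= /upd eqn_leq ltnn andbF V1 M1.
        by case: (H2 (eval e h)) => // ; move: lt; rewrite subn_eq0 => /negPf->.
      by constructor.
    split=> //= [|x xt]; rewrite /upd ?eqxx // !ltn_eqF ?F1 //.
    by rewrite ltnS ltnW.
  move: ge; rewrite negbK => /eqP ge.
  exists (set_reg (set_reg s1 t.+1 (reg s1 B - reg s1 t)) t 0).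
    rewrite -[3]/(1 + 2); apply: exec_seq E1 _; apply: exec_seq; first by constructor.
    apply: exec_if_false; first by rewrite /= /upd eqxx F1 // V1.
    by constructor.
  split=> //= [|x xt]; rewrite /upd ?eqxx.
    by rewrite H3 //; apply/eqP.
  by rewrite !ltn_eqF ?F1 // ltnS ltnW.
- by apply: (bin Add addn e1 e2 _ IH1 IH2) => // *; constructor.
- by apply: (bin Defs.Sub subn e1 e2 _ IH1 IH2) => // *; constructor.
Qed.

Lemma rep_temp s h s' : rep s h -> cells s' = cells s ->
  (forall x, x <= B -> reg s' x = reg s x) -> rep s' h.
Proof.
case=> [H1 H2 H3 H4] M R; split; rewrite ?M ?R //.
by move=> x xB; rewrite R ?H1 // ltnW.
Qed.

Lemma rep_setr s h x : x < B -> rep s h ->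
  forall s', cells s' = cells s ->
  (forall z, z <= B -> z != x -> reg s' z = reg s z) -> rep s' (setr h x (reg s' x)).
Proof.
move=> xB [H1 H2 H3 H4] s' M R; have RB : reg s' B = reg s B.
  by rewrite R // gtn_eqF.
split; rewrite ?M ?RB //.
move=> z zB; rewrite /=; case: eqP => [->//|/eqP zx].
by rewrite R ?H1 // ltnW.
Qed.

Lemma exec_ccmd c s h : rep s h -> wf_cmd c ->
  exists s' t, [/\ exec (ccmd c) s t s', t <= time_bound c h,
    reg s' B = reg s B & rep s' (run c h)].
Proof.
elim: c s h => [|x e|a e1 e2|c1 IH1 c2 IH2|e c1 IH1 c2 IH2|x y c IH] s h hs /=.
- by exists s, 1; split=> //; constructor.
- case/andP=> xB we.
  have [s1 E1 [M1 V1 F1]] := exec_cexpr hs we (ltnSn B).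
  exists (set_reg (set_reg s1 B.+2 0) x (eval e h)), (time_expr e + 2); split=> //.
  + apply: exec_seq E1 _; apply: (@exec_seq _ _ _ _ _ 1 1); first by constructor.
    set s2 := set_reg s1 _ _.
    have ->: eval e h = reg s2 B.+1 + reg s2 B.+2.
      by rewrite /= /upd eqxx ltn_eqF // V1 addn0.
    by constructor.
  + by rewrite /= /upd gtn_eqF // ltn_eqF ?F1 // ltnS ltnW.
  + set s2 := set_reg _ x _; have ->: eval e h = reg s2 x by rewrite /= /upd eqxx.
    apply: rep_setr hs _ _ _ => //= z zB /negPf zx; rewrite /upd zx.
    by rewrite ltn_eqF ?F1 // ltnS ltnW.
- case/and3P=> a16 w1 w2; have [s1 E1 [M1 V1 F1]] := exec_cexpr hs w1 (ltnSn B).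
  have [s2 E2 [M2 V2 F2]] := @exec_address s1 a B.+1 (ltnSn B).
  have hs2 : rep s2 h.
    by apply: rep_temp hs _ _ => [|x xB]; rewrite ?M2 // F2 ?F1.
  have [s3 E3 [M3 V3 F3]] := exec_cexpr hs2 w2 (ltnW (ltnSn B.+1) : B < B.+2).
  have RB : reg s3 B = reg s B by rewrite F3 ?F2 ?F1 // ltnS ltnW.
  eexists; exists (time_expr e1 + (7 + (time_expr e2 + 1))); split=> /=.
  + apply: exec_seq E1 _; apply: exec_seq E2 _; apply: exec_seq E3 _.
    by constructor.
  + lia.
  + by [].
  + case: (hs) => [H1 H2 H3 H4]; split=> //=.
    * by move=> x xB; rewrite F3 ?F2 ?F1 ?H1 //; lia.
    * move=> b; rewrite RB /upd; case: eqP => [->|_]; last by rewrite M3 M2 M1.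
      by right; rewrite F3 // V2 F1 ?leq_addr.
    * by rewrite RB.
    * move=> b i b16; rewrite RB V3 F3 // V2 V1 F1 // /upd.
      rewrite eqn_add2l; case: (b =P a) => [->|ba].
        rewrite eqn_add2r eqn_mul2l /=; case: eqP => // _.
        by rewrite M3 M2 M1 H4.
      by rewrite ifF ?M3 ?M2 ?M1 ?H4 //; apply/eqP; lia.
- case/and3P=> w1 w2 /hasPn nb.
  have [s1 [t1 [E1 T1 B1 R1]]] := IH1 _ _ hs w1.
  have [s2 [t2 [E2 T2 B2 R2]]] := IH2 _ _ R1 w2.
  exists s2, (t1 + t2); split=> //; first exact: exec_seq E1 E2.
    rewrite leq_add //; apply: leq_trans T2 _; rewrite leq_eqVlt; apply/orP; left.
    apply/eqP/time_bound_ext => x /nb/= nx.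
    by have [-> //] := frame_run c1 h.
  by rewrite B2.
- case/and3P=> we w1 w2; have [s0 E0 [M0 V0 F0]] := exec_cexpr hs we (ltnSn B).
  have hs0 : rep s0 h by apply: rep_temp hs _ _ => // x xB; rewrite F0.
  have B0 : reg s0 B = reg s B by rewrite F0.
  have [nz|/negPn/eqP z] := boolP (eval e h != 0).
    have [s1 [t1 [E1 T1 B1 R1]]] := IH1 _ _ hs0 w1.
    exists s1, (time_expr e + t1.+1); split=> //; last by rewrite B1.
      by apply: exec_seq E0 _; apply: exec_if_true => //; rewrite V0.
    lia.
  have [s1 [t1 [E1 T1 B1 R1]]] := IH2 _ _ hs0 w2.
  exists s1, (time_expr e + t1.+1); split=> //; last by rewrite B1.
    by apply: exec_seq E0 _; apply: exec_if_false => //; rewrite V0.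
  lia.
- case/and5P=> xB yB xyc wc /hasPn nb.
  case/and3P: (xyc) => xy xc yc.
  pose body g := let h' := run c g in setr h' x (rv h' x).+1; set N := rv h y.
  set W := While _ _.
  (* Induction on the number [k] of remaining rounds, which is what the test register [B.+1] holds.
     A round costs four steps on top of the body: the loop test and three instructions. *)
  have bnd k : k <= N -> forall s g, rep s g -> rv g x = N - k -> rv g y = N ->
      reg s B.+1 = k -> time_bound c g = time_bound c h ->
      exists s' t, [/\ exec W s t s', t <= k * (time_bound c h + 4) + 1,
        reg s' B = reg s B & rep s' (iter k body g)].
    elim: k => [|k IHk] kN {hs}s g hs gx gy sB tg.
      by exists s, 1; split=> //; apply: exec_while_end.
    have [s1 [t1 [E1 T1 B1 R1]]] := IH _ _ hs wc.
    have [fR fA] := frame_run c g.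
    pose s2 := set_reg s1 B.+1 1.
    pose s3 := set_reg s2 x (reg s2 x + reg s2 B.+1).
    pose s4 := set_reg s3 B.+1 (reg s3 y - reg s3 x).
    have xB1 : x == B.+1 = false by rewrite ltn_eqF // ltnW.
    have yB1 : y == B.+1 = false by rewrite ltn_eqF // ltnW.
    have s1x : reg s1 x = N - k.+1 by case: R1 => H1 _ _ _; rewrite H1 ?fR.
    have s1y : reg s1 y = N by case: R1 => H1 _ _ _; rewrite H1 ?fR.
    have s4x : reg s4 x = (N - k.+1).+1.
      by rewrite /= /upd xB1 !eqxx s1x addn1.
    have B4 : reg s4 B = reg s1 B.
      by rewrite /= /upd ltn_eqF // gtn_eqF.
    have R4 : rep s4 (body g).
      rewrite /body fR // gx -s4x; apply: rep_setr R1 _ _ _ => // z zB /negPf zx.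
      by rewrite /= /upd ltn_eqF // zx.
    have [||||s' [t' [E' T' B' R']]] := IHk (ltnW kN) s4 _ R4.
    + by rewrite /= eqxx fR // gx; lia.
    + by rewrite /= eq_sym (negPf xy) fR.
    + rewrite /= /upd yB1 xB1 !eqxx eq_sym (negPf xy) s1x s1y; lia.
    + rewrite -tg; apply: time_bound_ext => z /nb/=; rewrite inE => /norP[/negPf zx zc].
      by rewrite /= zx fR.
    exists s', ((t1 + (1 + (1 + 1))) + t').+1; split.
    + apply: exec_while_loop E'; first by rewrite sB.
      by apply: exec_seq E1 _; do 2![apply: exec_seq; first by constructor]; constructor.
    + rewrite -tg in T1 T' *; lia.
    + by rewrite B' B4.
    + by rewrite iterSr.
  pose s1 := set_reg s x 0; pose s2 := set_reg s1 B.+1 (reg s1 y - reg s1 x).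
  have xB1 : x == B.+1 = false by rewrite ltn_eqF // ltnW.
  have R2 : rep s2 (setr h x 0).
    rewrite (_ : 0 = reg s2 x); last by rewrite /= /upd xB1 eqxx.
    apply: rep_setr hs _ _ _ => // z zB /negPf zx.
    by rewrite /= /upd ltn_eqF // zx.
  have [||||s' [t' [E' T' B' R']]] := bnd N (leqnn N) s2 _ R2.
  + by rewrite /= eqxx subnn.
  + by rewrite /= eq_sym (negPf xy).
  + rewrite /= /upd !eqxx eq_sym (negPf xy) subn0.
    by case: hs => H1 _ _ _; rewrite H1.
  + apply: time_bound_ext => z /nb/=; rewrite inE => /norP[/negPf zx zc].
    by rewrite /= zx.
  exists s', (1 + (1 + t')); split=> //.
  + by apply: exec_seq; [constructor|apply: exec_seq; [constructor|]].
  + lia.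
  + by rewrite B' /= /upd ltn_eqF // gtn_eqF.
Qed.

End Language.

(** * Maximum weight bipartite matching *)

(** Old and new terms appear on opposite sides to avoid truncated subtraction. *)
Lemma sum_upd n (P : nat -> nat) f i v : i < n ->
  \sum_(x < n) P (upd f i v x) + P (f i) = \sum_(x < n) P (f x) + P v.
Proof.
move=> lt_in; pose j := Ordinal lt_in.
rewrite (bigD1 j) //= [in RHS](bigD1 j) //= {1}/upd eqxx.
rewrite (eq_bigr (fun x : 'I_n => P (f x))); last first.
  by move=> x; rewrite /upd -val_eqE /= => /negPf->.
lia.
Qed.

Section Matching.

Variables (n : nat) (a b w : nat -> nat).
Hypothesis a_lt : forall v, v < n -> a v < n.
Hypothesis b_lt : forall v, v < n -> b v < n.
Hypothesis wE : forall v, v < n ->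
  w v = \sum_(x < n) ((a x == a v) && (b x == b v)).

Section Potentials.
Variables (U V : nat -> nat).

(* Primal-dual state of the maximum weight bipartite matching between the
   values of [a] and those of [b], where the edge [v] joins [a v] to [b v] with
   weight [w v].  Edges are stored in [ML] and [MR] as successors, 0 meaning
   unmatched.  On the right, [x] is a vertex exempted from the invariant while
   an augmenting path is traced back; [x = n] means no exception. *)
Record hungarian (x h : nat) (ML MR : nat -> nat) : Prop := Hungarian {
  hg_feasible : forall v, v < n -> w v <= U (a v) + V (b v);
  hg_level : forall i, i < n -> h <= U i;
  hg_freeL : forall i, i < n -> ML i = 0 -> U i = h;
  hg_freeR : forall j, j < n -> j != x -> MR j = 0 -> V j = 0;
  hg_mateL : forall i e, i < n -> ML i = e.+1 ->
    [/\ e < n, a e = i, U i + V (b e) = w e, MR (b e) = e.+1 & b e != x];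
  hg_mateR : forall j e, j < n -> j != x -> MR j = e.+1 ->
    [/\ e < n, b e = j & ML (a e) = e.+1] }.

Definition tight v := U (a v) + V (b v) == w v.

(** The alternating forest of a search. [VR j] is the successor of the tight edge by which [j] was
    reached. Ranks decrease along the path back to a free left vertex, so tracing it back
    terminates. *)
Record forest (s : nat) (ML VL VR rk : nat -> nat) : Prop := Forest {
  fo_free : forall i, i < n -> ML i = 0 -> VL i != 0;
  fo_mate : forall i e, i < n -> VL i != 0 -> ML i = e.+1 -> VR (b e) != 0;
  fo_pred : forall j e, j < n -> VR j = e.+1 ->
    [/\ e < n, b e = j, tight e & VL (a e) != 0];
  fo_rank : forall j e, j < n -> VR j = e.+1 ->
    rk j < s /\ forall e', ML (a e) = e'.+1 -> rk (b e') < rk j }.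

(** An augmentation starts here: no matching edge ends at [x], so exempting it is harmless. *)
Lemma hungarian_hole x h ML MR : x < n -> MR x = 0 ->
  hungarian n h ML MR -> hungarian x h ML MR.
Proof.
move=> xn x0 [H1 H2 H3 H4 H5 H6]; split=> // [j jn _|i e lti Mi|j e jn _].
- by apply: H4 => //; rewrite ltn_eqF.
- have [? ? ? Mb _] := H5 i e lti Mi; split=> //.
  by apply: contraPneq Mb => ->; rewrite x0.
- by apply: H6 => //; rewrite ltn_eqF.
Qed.

(* Only right vertices of rank at most that of [x] are considered: their search
   paths avoid the part of the matching already changed when [x] is reached. *)
Definition traceable (x : nat) (ML VR rk : nat -> nat) : Prop :=
  forall j, j < n -> VR j != 0 -> rk j <= rk x -> exists e,
    [/\ VR j = e.+1, e < n, b e = j, tight e &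
        forall e', ML (a e) = e'.+1 -> VR (b e') != 0 /\ rk (b e') < rk j].

Lemma forest_traceable s x ML VL VR rk :
  forest s ML VL VR rk -> traceable x ML VR rk.
Proof.
move=> [F1 F2 F3 F4] j jn; case Ej: (VR j) => [//|e] _ _; exists e.
have [en be te Va] := F3 _ _ jn Ej; have [_ Hr] := F4 _ _ jn Ej.
split=> // e' Me; split; last exact: Hr.
by apply: F2 Va Me; apply: a_lt.
Qed.

(** Matching [x] along its predecessor edge takes [a e] away from its former partner [x'], whose
    entry in [MR] is now stale: this is what the exemption is for. The hole moves to [x'], of
    smaller rank, unless [a e] was free and the matching has grown. *)
Lemma augment_step x h ML MR VR rk e :
  x < n -> VR x = e.+1 -> hungarian x h ML MR -> traceable x ML VR rk ->
  let e' := ML (a e) in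
  let ML' := upd ML (a e) e.+1 in
  let x' := if e' == 0 then n else b e'.-1 in
  [/\ hungarian x' h ML' (upd MR x e.+1),
      e < n,
      \sum_(i < n) (ML' i != 0) = \sum_(i < n) (ML i != 0) + (e' == 0) &
      e' != 0 -> [/\ e'.-1 < n, x' < n, VR x' != 0, rk x' < rk x & traceable x' ML' VR rk]].
Proof.
move=> xn VRx HG TR; have := TR x xn; rewrite VRx => /(_ isT (leqnn _)).
case=> _ [[<-] en be te He] e' ML' x'; have [H1 H2 H3 H4 H5 H6] := HG.
have an := a_lt en; have xNn : x != n by rewrite ltn_eqF.
have x'P e2 : e' = e2.+1 -> [/\ e2 < n, x' = b e2, b e2 < n, b e2 != x & a e2 = a e].
  move=> E; have [? ? ? ? ?] := H5 _ _ an E.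
  by split=> //; rewrite ?/x' ?E ?b_lt.
have x0 : e' = 0 -> x' = n by rewrite /x' => ->.
have x'x : x' != x.
  case E: e' => [|e2]; first by rewrite x0 // eq_sym.
  by have [_ -> _ ? _] := x'P _ E.
have a0 i : ML' i = 0 -> i != a e /\ ML i = 0.
  by rewrite /ML' /upd; case: ifP.
split=> //.
- split=> //.
  + by move=> i lti /a0[_]; apply: H3.
  + move=> j jn jx'; rewrite /upd; case: ifP => // /negbT jx; exact: H4.
  + move=> i e1 lti; rewrite /ML' /upd; case: eqP => [-> [<-]|/eqP ia Mi].
      by rewrite be eqxx eq_sym; split=> //; have /eqP := te; rewrite be.
    have [? Ea ? Mb bx] := H5 _ _ lti Mi; rewrite (negPf bx); split=> //.
    case E: e' => [|e2]; first by rewrite x0 // ltn_eqF ?b_lt.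
    (* The only matching edge at the new hole was [e2], and its left end [a e] has just been
       rematched. *)
    have [_ -> _ _ E2] := x'P _ E; apply: contraNneq ia => Eb.
    have [_ _ _ M2 _] := H5 _ _ an E.
    have E12 : e1 = e2 by move: Mb; rewrite Eb M2 => -[].
    by rewrite -Ea E12 E2.
  + move=> j e1 jn jx'; rewrite /upd; case: eqP => [-> [<-]|/eqP jx Mj].
      by rewrite /ML' /upd eqxx.
    have [? be1 Ma] := H6 _ _ jn jx Mj; split=> //.
    rewrite /ML' /upd; case: eqP => // Ea; rewrite Ea in Ma.
    have [_ E' _ _ _] := x'P _ Ma.
    by rewrite -be1 E' eqxx in jx'.
- have := sum_upd (fun m => (m != 0) : nat) ML e.+1 an.
  by rewrite /= -/ML' -/e'; lia.
- case E: e' => [//|e2] _ /=; have [e2n E' ? ? Ea] := x'P _ E.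
  have [V2 rk2] := He _ E; rewrite E'; split=> // j jn Vj lej.
  have [e3 [? e3n ? ? H]] := TR j jn Vj (leq_trans lej (ltnW rk2)).
  (* If [e3] left [a e], then [x'] would have smaller rank than [j], contradicting the choice of
     [j]. *)
  exists e3; split=> // e4; rewrite /ML' /upd; case: eqP => [E3|_]; last exact: H.
  have [] := H e2; first by rewrite E3.
  by move=> _; rewrite ltnNge lej.
Qed.

End Potentials.

(** A class has at most [n] vertices, so potentials [n] on the left alone cover all weights. *)
Lemma hungarian_init MR ML U V :
  (forall i, i < n -> ML i = 0) -> (forall j, j < n -> MR j = 0) ->
  (forall i, i < n -> U i = n) -> (forall j, j < n -> V j = 0) ->
  hungarian U V n n ML MR.
Proof.
move=> ML0 MR0 Un V0; split=> // [v vn|i /Un->//|i lti _|j jn _ _|i e /ML0->//|j e /MR0->//].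
- rewrite Un ?a_lt // wE //; apply: leq_trans (leq_addr _ _).
  apply: (@leq_trans (\sum_(x < n) 1)); last by rewrite sum_nat_const card_ord muln1.
  by apply: leq_sum => x _; apply: leq_b1.
- by rewrite Un.
- by rewrite V0.
Qed.

(** The change preserves the sum of potentials on edges with both ends reached. An edge from a
    reached left to an unreached right vertex is not tight by [closed], so by integrality it has
    slack at least one. All free left vertices are reached, so their common level falls by one. *)
Lemma hungarian_adjust h s U V U' V' ML MR VL VR rk :
  hungarian U V n h.+1 ML MR -> forest U V s ML VL VR rk ->
  (forall j, j < n -> VR j != 0 -> exists e, MR j = e.+1 /\ VL (a e) != 0) ->
  (forall v, v < n -> VL (a v) != 0 -> tight U V v -> VR (b v) != 0) ->
  (forall i, i < n -> U' i = U i - (VL i != 0)) ->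
  (forall j, j < n -> V' j = V j + (VR j != 0)) ->
  hungarian U' V' n h ML MR.
Proof.
move=> [H1 H2 H3 H4 H5 H6] [F1 F2 F3 F4] mate closed UE VE.
split=> //.
- move=> v vn; rewrite UE ?a_lt // VE ?b_lt //.
  have := H1 v vn; have := H2 _ (a_lt vn); have := closed v vn; rewrite /tight.
  case: (VL _ != 0) => /= [/(_ isT)|_]; last by lia.
  case: (VR _ != 0) => /= [_|]; first by lia.
  by case: eqP => [_ /(_ isT)|]; lia.
- by move=> i lti; rewrite UE //; have := H2 i lti; case: (_ != 0); lia.
- by move=> i lti Mi; rewrite UE // H3 // F1 // subn1.
- move=> j jn jn' Mj; rewrite VE // (H4 j jn jn' Mj).
  case Vj: (VR j) => [//|e]; have [|e' []] := mate j jn; first by rewrite Vj.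
  by rewrite Mj.
- move=> i e lti Mi; have [en ae te Mb bn] := H5 _ _ lti Mi; split=> //.
  rewrite UE // VE ?b_lt //.
  (* The search reaches both ends of a matching edge or neither, so the edge stays tight. *)
  have -> : (VL i != 0) = (VR (b e) != 0).
    apply/idP/idP => [Vi|Vb]; first exact: F2 Vi Mi.
    have [e' []] := mate _ (b_lt en) Vb.
    by rewrite Mb => -[<-]; rewrite ae.
  by have := H2 i lti; case: (_ != 0); lia.
Qed.

(** * Linear programming duality for the matching *)

Section Optimum.
Variables (U V ML MR : nat -> nat).
Hypothesis HG : hungarian U V n 0 ML MR.

(** Weak duality. On a consistent [W] each label of [a] goes with one label of [b] and conversely,
    so [W] lies in classes that form a matching, and feasibility bounds each class by the potentials
    of its two ends. *)
Lemma consistent_le (W : {set 'I_n}) :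
  {in W &, forall u v : 'I_n, (a u == a v) = (b u == b v)} ->
  #|W| <= \sum_(i < n) U i + \sum_(j < n) V j.
Proof.
move=> cons; pose Wi (i : 'I_n) := [set v in W | a v == i].
have -> : #|W| = \sum_(i < n) #|Wi i|.
  rewrite -sum1_card (partition_big (fun v : 'I_n => Ordinal (a_lt (ltn_ord v))) xpredT) //=.
  apply: eq_bigr => i _; rewrite -sum1_card; apply: eq_bigl => v.
  by rewrite inE -val_eqE.
have le i : #|Wi i| <= U i + \sum_(j < n | [exists v in Wi i, b v == j]) V j.
  have [->|[v vW]] := set_0Vmem (Wi i); first by rewrite cards0.
  have := vW; rewrite inE => /andP[vW' /eqP ai].
  apply: (@leq_trans (w v)); last first.
    apply: leq_trans (hg_feasible HG (ltn_ord v)) _; rewrite ai leq_add2l.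
    rewrite (bigD1 (Ordinal (b_lt (ltn_ord v)))) /= ?leq_addr //.
    by apply/existsP; exists v; rewrite vW /=.
  rewrite wE // -sum1_card big_mkcond /=; apply: leq_sum => x _.
  case: ifP => //; rewrite inE => /andP[xW /eqP xi].
  by rewrite -cons // xi ai eqxx.
apply: leq_trans (leq_sum _ (fun i _ => le i)) _.
rewrite big_split leq_add2l /= (exchange_big_dep xpredT) //=.
apply: leq_sum => j _.
(* A right vertex is charged by at most one left vertex, since on [W] equal labels of [b] force
   equal labels of [a]. *)
have [i /exists_inP[v vW /eqP bv]|none] :=
  pickP [pred i : 'I_n | [exists v in Wi i, b v == j]]; last first.
  by rewrite big_pred0.
rewrite (big_pred1 i) // => i'; apply/exists_inP/eqP => [[v' v'W /eqP bv']|->]; last first.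
  by exists v => //; apply/eqP.
move: vW v'W; rewrite !inE => /andP[vW /eqP ai] /andP[v'W /eqP ai'].
by apply/val_inj; rewrite /= -ai -ai'; apply/eqP; rewrite cons // bv bv'.
Qed.

(** Complementary slackness at level 0: matching edges are tight and unmatched vertices have
    potential 0, so the classes of the matching edges contain enough vertices. *)
Lemma matching_consistent : exists2 W : {set 'I_n},
  {in W &, forall u v : 'I_n, (a u == a v) = (b u == b v)} &
  \sum_(i < n) U i + \sum_(j < n) V j <= #|W|.
Proof.
have [H1 H2 H3 H4 H5 H6] := HG.
pose W := [set v : 'I_n | (ML (a v) != 0) && (b (ML (a v)).-1 == b v)].
exists W.
  move=> u v; rewrite !inE; case Eu: (ML (a u)) => [//|e] /= /eqP bu.
  case Ev: (ML (a v)) => [//|e'] /= /eqP bv.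
  have [en ae _ Mb _] := H5 _ _ (a_lt (ltn_ord u)) Eu.
  have [en' ae' _ Mb' _] := H5 _ _ (a_lt (ltn_ord v)) Ev.
  apply/eqP/eqP => E; first by move: Eu; rewrite E Ev => -[Ee]; rewrite -bu -bv Ee.
  move: Mb Mb'; rewrite bu bv E => -> [] E'.
  by rewrite -ae -ae' E'.
have -> : #|W| = \sum_(i < n) #|[set v in W | a v == i]|.
  rewrite -sum1_card (partition_big (fun v : 'I_n => Ordinal (a_lt (ltn_ord v))) xpredT) //=.
  apply: eq_bigr => i _; rewrite -sum1_card; apply: eq_bigl => v.
  by rewrite inE -val_eqE.
(* A right potential is charged to the left partner, recognised by both ends storing the same edge;
   free right vertices have potential 0. *)
have VE : \sum_(j < n) V j <= \sum_(i < n) \sum_(j < n | (ML i != 0) && (ML i == MR j)) V j.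
  rewrite (exchange_big_dep xpredT) //=; apply: leq_sum => j _.
  case Mj: (MR j) => [|e]; first by rewrite H4 // ltn_eqF.
  have [|en be Ma] := H6 _ _ (ltn_ord j) _ Mj; first by rewrite ltn_eqF.
  by rewrite (bigD1 (Ordinal (a_lt en))) /= ?leq_addr // Ma /= eqxx.
apply: leq_trans (leq_add (leqnn _) VE) _; rewrite -big_split /=.
apply: leq_sum => i _; case Mi: (ML i) => [|e] /=.
  by rewrite H3 // big_pred0.
have [en ae te Mb _] := H5 _ _ (ltn_ord i) Mi.
rewrite (big_pred1 (Ordinal (b_lt en))) => [|j] /=; last first.
  apply/eqP/eqP => [/esym Mj|->] //=.
  have [|_ be _] := H6 _ _ (ltn_ord j) _ Mj; first by rewrite ltn_eqF.
  by apply/val_inj.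
rewrite te wE // -sum1_card [X in _ <= X]big_mkcond /=; apply: leq_sum => v _.
case: eqP => //= av; case: eqP => //= bv.
by rewrite !inE av ae Mi /= bv !eqxx.
Qed.

Lemma optimumP dd :
  n <= dd + (\sum_(i < n) U i + \sum_(j < n) V j) <->
  exists2 D : {set 'I_n}, #|D| <= dd &
    {in ~: D &, forall u v : 'I_n, (a u == a v) = (b u == b v)}.
Proof.
split=> [le|[D leD cons]].
  have [W cons leW] := matching_consistent; exists (~: W); rewrite ?setCK //.
  by have := cardsC W; rewrite card_ord; lia.
have := consistent_le cons; have := cardsC D; rewrite card_ord; lia.
Qed.

End Optimum.
End Matching.

(** * Search for augmenting paths *)

Lemma uniq_lt_size n (s : seq nat) : uniq s -> {in s, forall x, x < n} -> size s <= n.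
Proof.
move=> us H; rewrite -[n in _ <= n](size_iota 0); apply: uniq_leq_size us _ => x xs.
by rewrite mem_iota /= add0n H.
Qed.

(* The successor of the last edge below [m] at the left vertex [i], or 0. *)
Fixpoint last_edge (a : nat -> nat) (i m : nat) : nat :=
  if m is m'.+1 then if a m' == i then m else last_edge a i m' else 0.

Lemma last_edge_le a i m : last_edge a i m <= m.
Proof. by elim: m => //= m IH; case: ifP => // _; apply: leqW. Qed.

Lemma last_edge_pred a i m : last_edge a i m != 0 -> a (last_edge a i m).-1 = i.
Proof. by elim: m => //= m IH; case: ifP => // /eqP. Qed.

Lemma last_edge_max a i m v : last_edge a i m <= v < m -> a v != i.
Proof.
elim: m => [|m IH] /=; first by lia.
case: ifP => [_ /andP[]|am /andP[lv]]; first by lia.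
by rewrite ltnS leq_eqVlt => /orP[/eqP->|vm]; [rewrite am | apply: IH; rewrite lv].
Qed.

Section Search.

Variables (n : nat) (a b w U V ML MR : nat -> nat) (h : nat).
Hypothesis a_lt : forall v, v < n -> a v < n.
Hypothesis b_lt : forall v, v < n -> b v < n.
Hypothesis HG : hungarian n a b w U V n h ML MR.

(* Invariant of the breadth first search after [s] elementary steps, each of which
   pops a vertex or scans an edge: [qs] lists the left vertices queued so far, [qh]
   of which have been popped, [ls] the edges scanned so far, and [ep] is the
   successor of the next edge to scan at the vertex popped last, or 0. *)
Record searching (s : nat) (VL VR rk : nat -> nat) (qs ls : seq nat)
    (qh ep found : nat) : Prop := Searching {
  se_forest : forest n a b w U V s ML VL VR rk;
  se_uniq : uniq qs;
  se_lt : {in qs, forall i, i < n};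
  se_VL : forall i, i < n -> (VL i != 0) = (i \in qs);
  se_qh : qh <= size qs;
  se_mate : found = 0 -> forall j, j < n -> VR j != 0 ->
    exists e, MR j = e.+1 /\ VL (a e) != 0;
  se_found : forall j, found = j.+1 -> [/\ j < n, VR j != 0 & MR j = 0];
  se_edge : ep != 0 -> [/\ ep <= n, 0 < qh & a ep.-1 = nth 0 qs qh.-1];
  se_scanned_uniq : uniq ls;
  se_scanned : forall v, (v \in ls) = (v < n) &&
    ((a v \in take qh.-1 qs) ||
     [&& 0 < qh, a v == nth 0 qs qh.-1 & ep <= v]);
  se_closed : found = 0 ->
    {in ls, forall v, tight a b w U V v -> VR (b v) != 0};
  se_count : found = 0 -> s <= qh + size ls \/ ep = 0 /\ qh = size qs }.

Lemma forestS s VL VR rk : forest n a b w U V s ML VL VR rk ->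
  forest n a b w U V s.+1 ML VL VR rk.
Proof.
case=> F1 F2 F3 F4; split=> // j e jn Vj; have [? ?] := F4 j e jn Vj.
by split=> //; apply: leqW.
Qed.

Lemma search_init (VL VR : nat -> nat) qs :
  (forall j, j < n -> VR j = 0) -> (forall i, i < n -> VL i = (ML i == 0) :> nat) ->
  qs = [seq i <- iota 0 n | ML i == 0] ->
  searching 0 VL VR (fun=> 0) qs [::] 0 0 0.
Proof.
move=> VR0 VLE qsE.
have mem_qs i : (i \in qs) = (ML i == 0) && (i < n).
  by rewrite qsE mem_filter mem_iota.
split=> //.
- split=> [i lti Mi|i e lti|j e jn|j e jn].
  + by rewrite VLE // Mi.
  + by rewrite VLE // => Mi E; rewrite E in Mi.
  + by rewrite VR0.
  + by rewrite VR0.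
- by rewrite qsE filter_uniq ?iota_uniq.
- by move=> i; rewrite mem_qs => /andP[].
- by move=> i lti; rewrite VLE // mem_qs lti andbT; case: (ML i).
- by move=> _ j jn; rewrite VR0.
- by move=> v; rewrite take0 andbF.
- by left.
Qed.

(** The number of steps is fixed in advance, so a successful search has to idle; [search_idle] does
    the same for an exhausted one. *)
Lemma search_done s VL VR rk qs ls qh ep found :
  found != 0 -> searching s VL VR rk qs ls qh ep found ->
  searching s.+1 VL VR rk qs ls qh ep found.
Proof.
move=> f0 [] *; split=> //; first exact: forestS.
by move=> E; rewrite E in f0.
Qed.

Lemma search_idle s VL VR rk qs ls qh :
  qh = size qs -> searching s VL VR rk qs ls qh 0 0 ->
  searching s.+1 VL VR rk qs ls qh 0 0.
Proof. by move=> E [] *; split=> //; [apply: forestS | right]. Qed.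

Lemma search_pop s VL VR rk qs ls qh :
  qh < size qs -> searching s VL VR rk qs ls qh 0 0 ->
  searching s.+1 VL VR rk qs ls qh.+1 (last_edge a (nth 0 qs qh) n) 0.
Proof.
move=> lt [S1 S2 S3 S4 S5 S6 S7 S8 S9 S10 S11 S12]; split=> //=.
- exact: forestS.
- by move=> /last_edge_pred Ha; rewrite last_edge_le.
- move=> v; rewrite S10; have [vn|//] := ltnP v n; rewrite andTb.
  (* Edges are scanned in decreasing order, starting from the last one, so no edge of the vertex
     just popped counts as scanned yet. *)
  rewrite [X in _ = _ || X](_ : _ = false); last first.
    apply/negP => /andP[/eqP av le].
    by have := @last_edge_max a (nth 0 qs qh) n v; rewrite le vn av eqxx => /(_ isT).
  rewrite orbF; case: (qh) lt => [|q] lt; first by rewrite take0.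
  rewrite [in RHS](take_nth 0) ?mem_rcons ?inE; last exact: ltnW.
  by rewrite /= andbT orbC.
- by move=> _; have [|[_ E]] := S12 erefl; [left | rewrite E ltnn in lt].
Qed.

Section Edge.
Variables (s : nat) (VL VR rk : nat -> nat) (qs ls : seq nat) (qh v : nat).
Hypothesis SE : searching s VL VR rk qs ls qh v.+1 0.

Let vn : v < n. Proof. by case: SE => _ _ _ _ _ _ _ /(_ isT)[]. Qed.
Let qh0 : 0 < qh. Proof. by case: SE => _ _ _ _ _ _ _ /(_ isT)[]. Qed.
Let av : a v = nth 0 qs qh.-1. Proof. by case: SE => _ _ _ _ _ _ _ /(_ isT)[]. Qed.

(** Uniqueness of the queue rules out earlier vertices, and at the current one only edges from
    [v.+1] on have been scanned. *)
Lemma search_edge_fresh : v \notin ls.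
Proof.
have [_ S2 _ _ S5 _ _ _ _ S10 _ _] := SE.
rewrite S10 vn qh0 ltnn andbF orbF andTb.
have lt : qh.-1 < size qs by rewrite prednK.
apply/negP => /(nthP 0)[q]; rewrite size_take lt => ltq.
rewrite nth_take // av => /eqP; rewrite nth_uniq ?ltn_eqF //.
exact: ltn_trans lt.
Qed.

(** Stated for every extension of the queue, because the same step may append a vertex; the popped
    prefix does not change. *)
Let scan qs' : prefix qs qs' -> forall x, (x \in v :: ls) = (x < n) &&
  ((a x \in take qh.-1 qs') ||
   [&& 0 < qh, a x == nth 0 qs' qh.-1 & last_edge a (a v) v <= x]).
Proof.
have [_ _ _ _ S5 _ _ _ _ S10 _ _] := SE.
case/prefixP=> t ->.
have lt : qh.-1 < size qs by rewrite prednK.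
move=> x; rewrite take_cat nth_cat lt inE S10 qh0 !andTb -av.
have [->|xv] := eqVneq x v; first by rewrite vn eqxx last_edge_le orbT.
have [xn|//] := ltnP x n; rewrite !andTb orFb; congr (_ || _).
have [ax|//] := eqVneq (a x) (a v); rewrite !andTb.
rewrite ltn_neqAle eq_sym xv andTb.
have [|vx] := leqP v x; first by move=> vx; rewrite (leq_trans (last_edge_le _ _ _) vx).
apply/esym/negP => le; have := @last_edge_max a (a v) v x.
by rewrite le vx ax eqxx => /(_ isT).
Qed.

Let next qs' : prefix qs qs' -> last_edge a (a v) v != 0 ->
  [/\ last_edge a (a v) v <= n, 0 < qh &
      a (last_edge a (a v) v).-1 = nth 0 qs' qh.-1].
Proof.
case/prefixP=> t -> /last_edge_pred ->; rewrite nth_cat prednK // (se_qh SE).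
split=> //; exact: leq_trans (last_edge_le _ _ _) (ltnW vn).
Qed.

Let count : s.+1 <= qh + size (v :: ls).
Proof.
have [_ _ _ _ _ _ _ _ _ _ _ S12] := SE.
by have [|[]//] := S12 erefl; rewrite /= addnS.
Qed.

Lemma search_skip : (tight a b w U V v -> VR (b v) != 0) ->
  searching s.+1 VL VR rk qs (v :: ls) qh (last_edge a (a v) v) 0.
Proof.
move=> Hv; have [S1 S2 S3 S4 S5 S6 S7 S8 S9 S10 S11 S12] := SE.
have pp : prefix qs qs by exact: prefix_refl.
split=> //.
- exact: forestS.
- exact: next.
- by rewrite /= search_edge_fresh.
- exact: scan.
- by move=> _ x; rewrite inE => /orP[/eqP->//|]; apply: S11.
- by left; apply: count.
Qed.

Hypotheses (tv : tight a b w U V v) (Vbv : VR (b v) = 0).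

Let VLav : VL (a v) != 0.
Proof. by rewrite (se_VL SE) ?a_lt // av mem_nth // prednK // (se_qh SE). Qed.

Let VRb x : VR x != 0 -> (x == b v) = false.
Proof. by apply: contraNF => /eqP->; rewrite Vbv. Qed.

Let updP x : upd VR (b v) v.+1 x != 0 = (VR x != 0) || (x == b v).
Proof. by rewrite /upd; case: (x == b v); rewrite ?orbT ?orbF. Qed.

(** All earlier ranks are below [s], so the step number is a valid rank for the newly reached
    [b v]. *)
Let forest_extend VL' :
  (forall i, i < n -> VL i != 0 -> VL' i != 0) ->
  (forall i e, i < n -> VL' i != 0 -> ML i = e.+1 -> VL i = 0 -> b e = b v) ->
  forest n a b w U V s.+1 ML VL' (upd VR (b v) v.+1) (upd rk (b v) s).
Proof.
move=> sub new; have [[F1 F2 F3 F4] _ _ _ _ _ _ _ _ _ _ _] := SE; split.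
- by move=> i lti Mi; apply: sub => //; apply: F1.
- move=> i e lti Vi Mi; rewrite updP; case Vi0: (VL i) => [|c].
    by rewrite (new i e) // eqxx orbT.
  by rewrite (F2 i e) // Vi0.
- move=> j e jn; rewrite /upd; case: eqP => [-> [<-]|_ Vj].
    by split=> //; apply: sub => //; apply: a_lt.
  have [? ? ? ?] := F3 _ _ jn Vj; split=> //; apply: sub => //; exact: a_lt.
- move=> j e jn; rewrite /upd; case: eqP => [_ [<-]|_ Vj].
    split=> // e' Me; have Vb := F2 _ _ (a_lt vn) VLav Me; rewrite VRb //.
    case E: (VR (b e')) => [|c]; first by rewrite E in Vb.
    have [e'n _ _ _ _] := hg_mateL HG (a_lt vn) Me.
    by have [] := F4 _ _ (b_lt e'n) E.
  have [lt H] := F4 _ _ jn Vj; split=> [|e' Me]; first exact: leqW.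
  have [en _ _ Va] := F3 _ _ jn Vj.
  by rewrite VRb; [apply: H | apply: F2 Me => //; apply: a_lt].
Qed.

Lemma search_mate e : MR (b v) = e.+1 ->
  searching s.+1 (upd VL (a e) 1) (upd VR (b v) v.+1) (upd rk (b v) s)
    (rcons qs (a e)) (v :: ls) qh (last_edge a (a v) v) 0.
Proof.
move=> Mb; have [S1 S2 S3 S4 S5 S6 S7 S8 S9 S10 S11 S12] := SE.
have bn : b v != n by rewrite ltn_eqF ?b_lt.
have [en be Ma] := hg_mateR HG (b_lt vn) bn Mb.
have an := a_lt en.
(* Otherwise [a e] was reached earlier, and with it its mate [b v]. *)
have new : a e \notin qs.
  rewrite -S4 // negbK; apply/eqP; case Va: (VL (a e)) => [//|c].
  have : VR (b e) != 0 by apply: (fo_mate S1) Ma => //; rewrite Va.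
  by rewrite be Vbv.
have pp : prefix qs (rcons qs (a e)) by rewrite -cats1 prefix_prefix.
have VLP x : (upd VL (a e) 1 x != 0) = (VL x != 0) || (x == a e).
  by rewrite /upd; case: (x == a e); rewrite ?orbT ?orbF.
split=> //.
- apply: forest_extend => [i _ Vi|i e' lti]; rewrite VLP ?Vi //.
  by move=> + + V0; rewrite V0 /= => /eqP->; rewrite Ma => -[<-].
- by rewrite rcons_uniq new.
- by move=> i; rewrite mem_rcons inE => /orP[/eqP->//|]; apply: S3.
- by move=> i lti; rewrite VLP S4 // mem_rcons inE orbC.
- by rewrite size_rcons leqW.
- move=> _ j jn; rewrite updP => /orP[Vj|/eqP->]; last first.
    by exists e; rewrite VLP eqxx orbT.
  by have [e' [? Ve]] := S6 erefl j jn Vj; exists e'; rewrite VLP Ve.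
- exact: next.
- by rewrite /= search_edge_fresh.
- exact: scan.
- move=> _ x; rewrite inE updP => /orP[/eqP->|xl tx]; first by rewrite eqxx orbT.
  by rewrite S11.
- by left; apply: count.
Qed.

Lemma search_found : MR (b v) = 0 ->
  searching s.+1 VL (upd VR (b v) v.+1) (upd rk (b v) s)
    qs (v :: ls) qh (last_edge a (a v) v) (b v).+1.
Proof.
move=> Mb; have [S1 S2 S3 S4 S5 S6 S7 S8 S9 S10 S11 S12] := SE.
have pp : prefix qs qs by exact: prefix_refl.
split=> //.
- by apply: forest_extend => // i e _ Vi _ V0; rewrite V0 in Vi.
- by move=> j [<-]; rewrite updP eqxx orbT b_lt.
- exact: next.
- by rewrite /= search_edge_fresh.
- exact: scan.
Qed.

End Edge.

(** Until the queue is exhausted, every step pops one of at most [n] vertices or scans one of at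
    most [n] edges; after [n + n] steps nothing is left. *)
Lemma search_end VL VR rk qs ls qh ep :
  searching (n + n) VL VR rk qs ls qh ep 0 ->
  forall v, v < n -> VL (a v) != 0 -> tight a b w U V v -> VR (b v) != 0.
Proof.
move=> SE; have [S1 S2 S3 S4 S5 S6 S7 S8 S9 S10 S11 S12] := SE.
have lq : size qs <= n by apply: uniq_lt_size.
have lls : size ls <= n.
  by apply: uniq_lt_size => // v; rewrite S10 => /andP[].
have [ep0 qhE] : ep = 0 /\ qh = size qs.
  have [le|//] := S12 erefl; split; last by lia.
  (* A pending edge together with the [n] scanned ones would make more than [n] edges. *)
  case: ep SE S8 {S10 S12} => [//|v] SE /(_ isT)[vn _ _].
  have us : uniq (v :: ls) by rewrite /= (search_edge_fresh SE) S9.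
  have : size (v :: ls) <= n; last by rewrite /=; lia.
  apply: uniq_lt_size us _ => x.
  by rewrite inE => /orP[/eqP->//|]; rewrite (se_scanned SE) => /andP[].
move=> v vn; rewrite S4 ?a_lt // => aq; apply: S11 => //.
rewrite S10 vn ep0 leq0n andbT /= qhE.
case/lastP: (qs) aq => [//|q x]; rewrite size_rcons /= nth_rcons ltnn eqxx.
by rewrite -cats1 take_size_cat // mem_cat inE.
Qed.

End Search.

(** * Cluster graphs and edit sets *)

Section EdgeSets.
Variable n : nat.
Implicit Types (E M : {set {set 'I_n}}) (r : rel nat) (f : nat -> nat).

(** Relations and labels live on [nat], like the arrays of the program; only arguments below [n]
    matter. *)
Definition edges_of r : {set {set 'I_n}} :=
  [set e | [exists u : 'I_n, exists v : 'I_n,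
    [&& u != v, e == [set u; v] & r u v]]].

Definition clusters f := edges_of (fun u v => f u == f v).

Definition sym_on r := forall u v, u < n -> v < n -> r u v = r v u.

Lemma set2_eq (u v u' v' : 'I_n) : u != v -> [set u; v] = [set u'; v'] ->
  u = u' /\ v = v' \/ u = v' /\ v = u'.
Proof.
move=> uv E; have := set21 u v; have := set22 u v; rewrite E !inE.
by case/orP=> /eqP Ev /orP[]/eqP Eu; subst; rewrite ?eqxx in uv; auto.
Qed.

Lemma edges_of_pairs r : edges_of r \subset pairs _.
Proof.
apply/subsetP=> e; rewrite !inE => /existsP[u /existsP[v /and3P[uv /eqP-> _]]].
by rewrite cards2 uv.
Qed.

Lemma mem_edges_of r (u v : 'I_n) : sym_on r ->
  ([set u; v] \in edges_of r) = (u != v) && r u v.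
Proof.
move=> sr; rewrite inE; apply/idP/andP => [|[uv ruv]]; last first.
  by apply/existsP; exists u; apply/existsP; exists v; rewrite uv eqxx.
case/existsP=> u' /existsP[v' /and3P[uv' /eqP/esym E ruv']].
by have [[<- <-]|[<- <-]] := set2_eq uv' E; rewrite ?uv' // eq_sym uv' sr.
Qed.

Lemma sym_clusters f : sym_on (fun u v => f u == f v).
Proof. by move=> u v _ _; rewrite eq_sym. Qed.

Lemma mem_clusters f (u v : 'I_n) :
  ([set u; v] \in clusters f) = (u != v) && (f u == f v).
Proof. exact: mem_edges_of (sym_clusters f). Qed.

Lemma eq_edges E E' : E \subset pairs _ -> E' \subset pairs _ ->
  (forall u v : 'I_n, u != v -> ([set u; v] \in E) = ([set u; v] \in E')) ->
  E = E'.
Proof.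
move=> sE sE' H; apply/setP=> e; case: (boolP (e \in pairs 'I_n)) => [|nP].
  by rewrite inE => /cards2P[u [v [uv ->]]]; apply: H.
by rewrite (negPf (contra (subsetP sE e) nP)) (negPf (contra (subsetP sE' e) nP)).
Qed.

Lemma eq_edges_of r r' : (forall u v, u < n -> v < n -> u != v -> r u v = r' u v) ->
  edges_of r = edges_of r'.
Proof.
move=> H; apply/setP=> e; rewrite !inE; apply: eq_existsb => u.
by apply: eq_existsb => v; case: eqP => //= /eqP uv; case: eqP => //= _; apply: H.
Qed.

Lemma symdiff_mem E M e : (e \in symdiff E M) = (e \in E) (+) (e \in M).
Proof. by rewrite !inE; case: (e \in E); case: (e \in M). Qed.

Lemma symdiffK E M : symdiff E (symdiff E M) = M.
Proof. by apply/setP=> e; rewrite !symdiff_mem addKb. Qed.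

Lemma symdiff_pairs E M : E \subset pairs _ -> M \subset pairs _ ->
  symdiff E M \subset pairs _.
Proof.
move=> sE sM; rewrite subUset (subset_trans (subsetDl _ _) sE).
exact: subset_trans (subsetDl _ _) sM.
Qed.

Lemma symdiff_edges_of r r' : sym_on r -> sym_on r' ->
  symdiff (edges_of r) (edges_of r') = edges_of (fun u v => r u v (+) r' u v).
Proof.
move=> sr sr'; apply: eq_edges; rewrite ?symdiff_pairs ?edges_of_pairs //.
move=> u v uv; rewrite symdiff_mem !mem_edges_of ?uv // => x y xn yn.
by rewrite sr // sr'.
Qed.

Lemma cluster_clusters f : cluster_graph (clusters f).
Proof.
pose P := preim_partition (fun u : 'I_n => f u) [set: 'I_n].
have PP : partition P [set: 'I_n] by apply: preim_partitionP.
exists P => //; apply: eq_edges => [||u v uv]; first exact: edges_of_pairs.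
  by apply/bigcupsP => B _; apply/subsetP => e; rewrite inE => /andP[].
have covP x : x \in cover P by case/and3P: PP => /eqP->.
have tP : trivIset P by case/and3P: PP.
have memP x y : (y \in pblock P x) = (f x == f y).
  by rewrite pblock_equivalence_partition ?inE // => ? ? ? _ _ _; split=> // /eqP->.
rewrite mem_clusters uv; apply/idP/bigcupP => [fuv|[B BP]].
  exists (pblock P u); first by rewrite pblock_mem.
  by rewrite !inE cards2 uv /= subUset !sub1set !memP eqxx.
rewrite !inE cards2 uv /= subUset !sub1set => /andP[uB vB].
by rewrite -memP (def_pblock tP BP uB).
Qed.

Lemma cluster_graphE E : cluster_graph E -> exists f, E = clusters f.
Proof.
case=> P PP ->; case/and3P: (PP) => /eqP cP tP _.
have covP x : x \in cover P by rewrite cP.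
pose g (x : 'I_n) : nat := if [pick y in pblock P x] is Some y then val y else 0.
have gE (x y : 'I_n) : (g x == g y) = (y \in pblock P x).
  apply/eqP/idP => [|yx]; last first.
    by rewrite /g (same_pblock tP yx).
  rewrite /g; case: pickP => [z zx|/(_ x)]; last by rewrite mem_pblock covP.
  case: pickP => [z' zy|/(_ y)]; last by rewrite mem_pblock covP.
  move=> /val_inj zz; rewrite -zz in zy.
  by rewrite -(same_pblock tP zx) (same_pblock tP zy) mem_pblock covP.
exists (fun x => if insub x is Some y then g y else 0).
apply: eq_edges => [||u v uv]; last 1 first.
- rewrite mem_clusters uv !valK gE /=; apply/bigcupP/idP => [[B BP]|vu].
    rewrite !inE cards2 uv /= subUset !sub1set => /andP[uB vB].
    by rewrite (def_pblock tP BP uB).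
  exists (pblock P u); first by rewrite pblock_mem.
  by rewrite !inE cards2 uv /= subUset !sub1set vu mem_pblock covP.
- by apply/bigcupsP => B _; apply/subsetP => e; rewrite inE => /andP[].
- exact: edges_of_pairs.
Qed.

Lemma cluster_edges_of r : sym_on r ->
  cluster_graph (edges_of r) <->
  exists f : nat -> nat, forall u v, u < n -> v < n -> u != v -> r u v = (f u == f v).
Proof.
move=> sr; split=> [/cluster_graphE[f E]|[f H]].
  exists f => u v un vn uv; have := mem_clusters f (Ordinal un) (Ordinal vn).
  by rewrite -E mem_edges_of // -val_eqE /= uv.
by rewrite (eq_edges_of H); apply: cluster_clusters.
Qed.

(** In a cluster graph the least vertex among [u] and its neighbours is the minimum of the clique of
    [u], so this easily computed labelling is correct as soon as any labelling is. *)
Lemma min_labels r F : sym_on r ->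
  (forall u, u < n -> [/\ F u < n, F u = u \/ r u (F u), F u <= u &
     forall v, v < n -> r u v -> F u <= v]) ->
  cluster_graph (edges_of r) <->
  (forall u v, u < n -> v < n -> u != v -> r u v = (F u == F v)).
Proof.
move=> sr HF; split=> [/(cluster_edges_of sr)[f Hf]|H]; last first.
  by apply/(cluster_edges_of sr); exists F.
have fF u : u < n -> f (F u) = f u.
  move=> un; have [Fn [->//|rF] _ _] := HF u un.
  have [->//|uF] := eqVneq (F u) u.
  by apply/eqP; move: rF; rewrite Hf // eq_sym.
have leF u v : u < n -> v < n -> f u = f v -> F u <= v.
  move=> un vn fuv; have [_ _ Fu Fv] := HF u un.
  have [<-//|uv] := eqVneq u v.
  by apply: Fv => //; rewrite Hf // fuv.
move=> u v un vn uv; rewrite Hf //; apply/eqP/eqP => [E|E].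
  have [Fun _ _ _] := HF u un; have [Fvn _ _ _] := HF v vn.
  by apply/eqP; rewrite eqn_leq !leF // fF.
by rewrite -fF // E fF.
Qed.

Definition compatible d E E' := exists2 D : {set 'I_n}, #|D| <= d &
  induced E (~: D) = induced E' (~: D).

Lemma compatible_clusters d f g : compatible d (clusters f) (clusters g) <->
  exists2 D : {set 'I_n}, #|D| <= d &
    {in ~: D &, forall u v : 'I_n, (f u == f v) = (g u == g v)}.
Proof.
have ind h (D : {set 'I_n}) (u v : 'I_n) : ([set u; v] \in induced (clusters h) (~: D)) =
    [&& u \in ~: D, v \in ~: D, u != v & h u == h v].
  rewrite inE mem_clusters subUset !sub1set.
  by case: (u \in ~: D); case: (v \in ~: D); case: (u != v); case: (h u == h v).
have sub h W : induced (clusters h) W \subset pairs 'I_n.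
  by apply/subsetP=> e; rewrite /induced in_set => /andP[/(subsetP (edges_of_pairs _))].
split=> -[D leD H]; exists D => //.
  move=> u v uD vD; have [->|uv] := eqVneq u v; first by rewrite !eqxx.
  by have := ind f D u v; rewrite H ind uD vD uv.
apply: eq_edges => [||u v uv].
- exact: sub.
- exact: sub.
by rewrite !ind; case: (boolP (u \in _)) => //= uD; case: (boolP (v \in _)) => //= vD; rewrite H.
Qed.

Definition toggle_pair (p q : nat) : rel nat := fun u v =>
  (p != q) && ((u == p) && (v == q) || (u == q) && (v == p)).

Fixpoint toggles (dg : nat -> nat) K : rel nat := fun u v =>
  if K is K'.+1 then
    toggles dg K' u v (+) toggle_pair (dg (K' + K')) (dg (K' + K').+1) u v
  else false.

Lemma sym_toggle_pair p q : sym_on (toggle_pair p q).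
Proof. by move=> u v _ _; rewrite /toggle_pair orbC; congr (_ && (_ || _)); exact: andbC. Qed.

Lemma sym_toggles dg K : sym_on (toggles dg K).
Proof.
by elim: K => //= K IH u v un vn; rewrite IH // (@sym_toggle_pair _ _ u v).
Qed.

Lemma toggles_ext dg dg' K : (forall j, j < K + K -> dg j = dg' j) ->
  toggles dg K =2 toggles dg' K.
Proof.
elim: K => //= K IH H u v; rewrite IH => [|j jK]; last by apply: H; lia.
by rewrite !H //; lia.
Qed.

Lemma edges_of_toggle_pair (p q : 'I_n) :
  edges_of (toggle_pair p q) = if p == q then set0 else [set [set p; q]].
Proof.
have [->|pq] := eqVneq p q.
  apply/setP=> e; rewrite in_set0; apply/negbTE/negP; rewrite inE.
  by case/existsP=> u /existsP[v]; rewrite /toggle_pair eqxx /= !andbF.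
apply: eq_edges => [||u v uv]; first exact: edges_of_pairs.
  by rewrite sub1set inE cards2 pq.
rewrite mem_edges_of; last exact: sym_toggle_pair.
rewrite uv /toggle_pair (_ : (p : nat) != q) //= inE.
apply/orP/eqP => [[] /andP[/eqP/val_inj-> /eqP/val_inj->] //|/set2_eq].
  by rewrite setUC.
by case/(_ uv) => -[-> ->]; rewrite !eqxx; [left|right].
Qed.

Lemma card_toggles dg K : (forall j, dg j < n) -> #|edges_of (toggles dg K)| <= K.
Proof.
move=> dgn; elim: K => [|K IH].
  rewrite (_ : edges_of _ = set0) ?cards0 //; apply/setP=> e; rewrite in_set0.
  by apply/negbTE/negP; rewrite inE => /existsP[u /existsP[v]]; rewrite !andbF.
pose p := Ordinal (dgn (K + K)); pose q := Ordinal (dgn (K + K).+1).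
have -> : edges_of (toggles dg K.+1) =
    symdiff (edges_of (toggles dg K)) (edges_of (toggle_pair p q)).
  by rewrite symdiff_edges_of //; [apply: sym_toggles|apply: sym_toggle_pair].
apply: leq_trans (leq_card_setU _ _) _; rewrite -addn1 leq_add //.
  by apply: leq_trans IH; apply: subset_leq_card; apply: subsetDl.
apply: leq_trans (subset_leq_card (subsetDl _ _)) _.
by rewrite edges_of_toggle_pair; case: ifP; rewrite ?cards0 ?cards1.
Qed.

(** Induction on [K], peeling off one edit at a time; once the set is empty, pairs of equal ends
    serve as padding. *)
Lemma toggles_complete M K : 0 < n -> M \subset pairs _ -> #|M| <= K ->
  exists2 dg, forall j, dg j < n & edges_of (toggles dg K) = M.
Proof.
move=> n0; elim: K M => [|K IH] M sM.
  rewrite leqn0 cards_eq0 => /eqP->; exists (fun=> 0) => //.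
  apply/setP=> e; rewrite in_set0.
  by apply/negbTE/negP; rewrite inE => /existsP[u /existsP[v]]; rewrite !andbF.
move=> cM.
have [p [q cM']] : exists p q : 'I_n,
    #|symdiff M (edges_of (toggle_pair p q))| <= K.
  have [->|[e eM]] := set_0Vmem M.
    exists (Ordinal n0), (Ordinal n0); rewrite edges_of_toggle_pair eqxx.
    by rewrite /symdiff !set0D setU0 cards0.
  have := subsetP sM e eM; rewrite inE => /cards2P[p [q [pq Ee]]].
  exists p, q; rewrite edges_of_toggle_pair (negPf pq) -Ee.
  rewrite (_ : symdiff _ _ = M :\ e).
    by have := cardsD1 e M; rewrite eM; lia.
  apply/setP=> e'; rewrite symdiff_mem !inE; have [->|] := eqVneq e' e.
    by rewrite eM.
  by rewrite addbF.
have [|dg dgn Edg] := IH _ _ cM'; first by rewrite symdiff_pairs ?edges_of_pairs.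
(* Pair number [K] has the ends [p] and [q]; later digits must be below [n] too, hence the default
   [q]. *)
exists (fun j => if j < K + K then dg j else if j == K + K then val p else val q).
  by move=> j; case: ifP => // _; case: ifP => _; apply: ltn_ord.
have -> : M = symdiff (symdiff M (edges_of (toggle_pair p q))) (edges_of (toggle_pair p q)).
  by apply/setP=> e; rewrite !symdiff_mem addbK.
rewrite -Edg symdiff_edges_of; [|exact: sym_toggles|exact: sym_toggle_pair].
apply: eq_edges_of => u v _ _ _ /=.
rewrite ltnn eqxx ltnNge leqnSn /= gtn_eqF //; congr (_ (+) _).
by apply: toggles_ext => j ->.
Qed.

End EdgeSets.

Lemma card_pairs n : #|pairs 'I_n| <= n * n.
Proof.
pose f (x : 'I_n * 'I_n) := [set x.1; x.2].
have : pairs _ \subset f @: setT.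
  apply/subsetP=> e; rewrite inE => /cards2P[u [v [_ ->]]].
  by apply/imsetP; exists (u, v).
move/subset_leq_card/leq_trans; apply; apply: leq_trans (leq_imset_card _ _) _.
by rewrite cardsT card_prod card_ord.
Qed.

(** * Layer by layer reachability *)

Section Reachability.
Variables (n l : nat) (G : temporal_graph 'I_n l) (k d : nat).
Implicit Types E : {set {set 'I_n}}.

Definition layer_clustering (i : nat) E := exists (j : 'I_l) (M : {set {set 'I_n}}),
  [/\ j = i :> nat, M \subset pairs _, #|M| <= k,
      E = symdiff (edges (G j)) M & cluster_graph E].

(* A dummy layer precedes the first one; deleting all vertices makes it
   compatible with every clustering. *)
Definition threshold i := if i == 0 then n else d.

Fixpoint reach (i : nat) E : Prop :=
  if i is i'.+1 then layer_clustering i' E /\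
    exists2 E', reach i' E' & compatible (threshold i') E' E
  else E = clusters n (fun=> 0).

(** Index 0 is the dummy layer, so layer [j] sits at [Es j.+1], and only positive indices compare
    two real layers. *)
Lemma reach_history i E : reach i E -> exists Es : nat -> {set {set 'I_n}},
  [/\ Es i = E, forall j, j < i -> layer_clustering j (Es j.+1) &
      forall j, 0 < j < i -> compatible d (Es j) (Es j.+1)].
Proof.
elim: i E => [|i IH] E; first by move=> _; exists (fun=> E); split=> // j; rewrite ltn0 andbF.
case=> layE [E' /IH[Es [Ei lay cmp]] cE'].
exists (fun j => if j == i.+1 then E else Es j); rewrite eqxx; split=> // j.
  by rewrite ltnS eqSS; case: eqP => [->//|/eqP ji le]; apply: lay; rewrite ltn_neqAle ji.
move=> /andP[j0 ji]; rewrite eqSS ltn_eqF //; case: eqP => [Ej|/eqP jni].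
  by move: cE'; rewrite Ej Ei /threshold -Ej gtn_eqF.
by apply: cmp; rewrite j0 ltn_neqAle jni.
Qed.

Lemma induced0 E : E \subset pairs _ -> induced E set0 = set0.
Proof.
move=> sE; apply/setP=> e; rewrite /induced !in_set subset0.
case: (boolP (e \in E)) => // /(subsetP sE); rewrite inE.
by have [->|//] := eqVneq e set0; rewrite cards0.
Qed.

Lemma TCE_reach : TCE G k d <-> exists E, reach l E.
Proof.
split=> [[M [cM bM [D leD HD]]]|[E /reach_history[Es [El lay cmp]]]].
  pose Es (i : nat) : {set {set 'I_n}} :=
    if i is i'.+1 then
      if insub i' is Some j then symdiff (edges (G j)) (M j) else set0
    else clusters n (fun=> 0).
  have EsS (j : 'I_l) : Es j.+1 = symdiff (edges (G j)) (M j).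
    by rewrite /= valK.
  exists (Es l); suff: forall i, i <= l -> reach i (Es i) by apply.
  elim=> [//|i IH] lti; split.
    have [sM ?] := cM (Ordinal lti); exists (Ordinal lti), (M (Ordinal lti)).
    by rewrite (EsS (Ordinal lti)).
  exists (Es i); first exact: IH (ltnW lti).
  case: i lti {IH} => [|i] lti.
    exists [set: 'I_n]; first by rewrite cardsT card_ord.
    rewrite setCT !induced0 ?edges_of_pairs // (EsS (Ordinal lti)).
    by apply: symdiff_pairs; [apply: edges_pairs | case: (cM (Ordinal lti))].
  have i1 : i < l.-1 by lia.
  exists (D (Ordinal i1)); first exact: leD.
  rewrite (EsS (Ordinal (ltnW lti))) (EsS (Ordinal lti)).
  exact: HD.
(* An edit set is recovered as the difference between a layer and its clustering. *)
exists (fun i : 'I_l => symdiff (edges (G i)) (Es i.+1)); split.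
- move=> i; rewrite /cluster_editing_set symdiffK.
  have [j [M [ji sM leM -> cE]]] := lay i (ltn_ord i).
  by rewrite (val_inj ji : j = i) in cE *; rewrite symdiffK.
- move=> i; have [j [M [ji sM leM -> cE]]] := lay i (ltn_ord i).
  by rewrite (val_inj ji : j = i) symdiffK.
have /fin_all_exists[D HD] : forall i : 'I_l.-1, exists D : {set 'I_n},
    #|D| <= d /\ induced (Es i.+1) (~: D) = induced (Es i.+2) (~: D).
  move=> i; have [|D] := cmp i.+1; first by have := ltn_ord i; lia.
  by exists D.
exists D => [i|i j j' ji j'i]; first by case: (HD i).
by rewrite !symdiffK ji j'i; case: (HD i).
Qed.

End Reachability.

(** * The compatibility test *)

Declare Scope cmd_scope.
Delimit Scope cmd_scope with cmd.
Bind Scope cmd_scope with cmd.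
Notation "c1 ;; c2" := (CSeq c1 c2)
  (at level 90, right associativity, format "'[v' c1 ;; '/' c2 ']'") : cmd_scope.

(** Truth is being nonzero, so truncated subtraction expresses comparisons. *)
Definition ELt e1 e2 := ESub e2 e1.
Definition EEq e1 e2 := ESub (ECst 1) (EAdd (ESub e1 e2) (ESub e2 e1)).
Definition EInc e := EAdd e (ECst 1).
Definition EDec e := ESub e (ECst 1).

(* The label arrays of the clusterings kept so far are appended to [LST]: those of
   the previous layer start at [lo_] and are [cnt_] in number, those of the current
   one start at [st_] and are [new_] in number, and [hi_] is the first free entry. *)
Notation n_ := 0 (only parsing).
Notation l_ := 1 (only parsing).
Notation k_ := 2 (only parsing).
Notation d_ := 3 (only parsing).
Notation nn_ := 4 (only parsing).
Notation n2_ := 5 (only parsing).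
Notation kk_ := 6 (only parsing).
Notation k2_ := 7 (only parsing).
Notation P_ := 8 (only parsing).
Notation off_ := 9 (only parsing).
Notation lo_ := 10 (only parsing).
Notation hi_ := 11 (only parsing).
Notation cnt_ := 12 (only parsing).
Notation dd_ := 13 (only parsing).
Notation st_ := 14 (only parsing).
Notation new_ := 15 (only parsing).
Notation i_ := 16 (only parsing).
Notation m_ := 17 (only parsing).
Notation e_ := 18 (only parsing).
Notation p_ := 19 (only parsing).
Notation ok_ := 20 (only parsing).
Notation good_ := 21 (only parsing).
Notation u_ := 22 (only parsing).
Notation v_ := 23 (only parsing).
Notation x_ := 24 (only parsing).
Notation y_ := 25 (only parsing).
Notation r_ := 26 (only parsing).
Notation h_ := 27 (only parsing).
Notation s_ := 28 (only parsing).
Notation qt_ := 29 (only parsing).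
Notation qh_ := 30 (only parsing).
Notation ep_ := 31 (only parsing).
Notation found_ := 32 (only parsing).
Notation val_ := 33 (only parsing).
Notation carry_ := 34 (only parsing).
Notation base_ := 35 (only parsing).
Notation ROW := 0 (only parsing).
Notation DIG := 1 (only parsing).
Notation ADJ := 2 (only parsing).
Notation LAB := 3 (only parsing).
Notation LST := 4 (only parsing).
Notation OLD := 5 (only parsing).
Notation WT := 6 (only parsing).
Notation HD := 7 (only parsing).
Notation NX := 8 (only parsing).
Notation PU := 9 (only parsing).
Notation PV := 10 (only parsing).
Notation ML := 11 (only parsing).
Notation MR := 12 (only parsing).
Notation VL := 13 (only parsing).
Notation VR := 14 (only parsing).
Notation QU := 15 (only parsing).

Coercion EReg : nat >-> expr.

Definition p_weights : cmd :=
  CFor u_ n_ (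
    CReg x_ (ECst 0);;
    CFor v_ n_ (
      CIf (EEq (EArr OLD v_) (EArr OLD u_))
        (CIf (EEq (EArr LAB v_) (EArr LAB u_)) (CReg x_ (EInc x_)) CSkip) CSkip);;
    CArr WT u_ x_).

(** Adjacency lists of the left vertices: [HD] starts and [NX] continues them, storing successors so
    that 0 ends a list. Each entry keeps the last match of an upward pass, so the lists run
    downwards. *)
Definition p_links : cmd :=
  CFor u_ n_ (
    CArr HD u_ (ECst 0);;
    CArr NX u_ (ECst 0);;
    CFor v_ n_ (
      CIf (EEq (EArr OLD v_) u_) (CArr HD u_ (EInc v_)) CSkip;;
      CIf (EEq (EArr OLD v_) (EArr OLD u_))
        (CIf (ELt v_ u_) (CArr NX u_ (EInc v_)) CSkip) CSkip)).

Definition p_init : cmd :=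
  CFor u_ n_ (
    CArr PU u_ n_;; CArr PV u_ (ECst 0);;
    CArr ML u_ (ECst 0);; CArr MR u_ (ECst 0)).

Definition p_roots : cmd :=
  CReg qt_ (ECst 0);;
  CFor u_ n_ (
    CArr VR u_ (ECst 0);; CArr VL u_ (ECst 0);;
    CIf (EArr ML u_) CSkip
      (CArr VL u_ (ECst 1);; CArr QU qt_ u_;; CReg qt_ (EInc qt_)));;
  CReg qh_ (ECst 0);; CReg ep_ (ECst 0);; CReg found_ (ECst 0).

(** One pop or one scan; without inner loops its cost is constant. *)
Definition p_step : cmd :=
  CIf found_ CSkip (CIf ep_
    (CReg x_ (EArr LAB (EDec ep_));;
     CIf (EEq (EAdd (EArr PU (EArr OLD (EDec ep_))) (EArr PV x_)) (EArr WT (EDec ep_)))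
       (CIf (EArr VR x_) CSkip
         (CArr VR x_ ep_;;
          CIf (EArr MR x_)
            (CReg y_ (EArr OLD (EDec (EArr MR x_)));;
             CArr VL y_ (ECst 1);; CArr QU qt_ y_;; CReg qt_ (EInc qt_))
            (CReg found_ (EInc x_))))
       CSkip;;
     CReg ep_ (EArr NX (EDec ep_)))
    (CIf (ELt qh_ qt_)
       (CReg ep_ (EArr HD (EArr QU qh_));; CReg qh_ (EInc qh_)) CSkip)).

Definition p_search : cmd := p_roots;; CFor s_ n2_ p_step.

(** [found_] is the successor of the current hole, and 0 once a free left vertex has absorbed it. *)
Definition p_augstep : cmd :=
  CIf found_
    (CReg y_ (EArr VR (EDec found_));;
     CReg x_ (EArr OLD (EDec y_));;
     CReg v_ (EArr ML x_);;
     CArr ML x_ y_;;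
     CArr MR (EDec found_) y_;;
     CIf v_ (CReg found_ (EInc (EArr LAB (EDec v_)))) (CReg found_ (ECst 0)))
    CSkip.

Definition p_augment : cmd := CFor s_ n2_ p_augstep.

Definition p_adjust : cmd :=
  CFor u_ n_ (
    CIf (EArr VL u_) (CArr PU u_ (EDec (EArr PU u_))) CSkip;;
    CIf (EArr VR u_) (CArr PV u_ (EInc (EArr PV u_))) CSkip);;
  CReg h_ (EDec h_).

Definition p_phase : cmd :=
  CIf h_ (p_search;; CIf found_ p_augment p_adjust) CSkip.

Definition p_matching : cmd := p_init;; CReg h_ n_;; CFor r_ n2_ p_phase.

Definition p_value : cmd :=
  CReg val_ (ECst 0);;
  CFor u_ n_ (CReg val_ (EAdd val_ (EAdd (EArr PU u_) (EArr PV u_)))).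

Definition p_compatible : cmd :=
  CFor u_ n_ (CArr OLD u_ (EArr LST (EAdd p_ u_)));;
  p_weights;; p_links;; p_matching;; p_value;;
  CIf (ESub n_ (EAdd dd_ val_)) CSkip (CReg ok_ (ECst 1)).

(** * Specifications of the pieces of the compatibility test *)

Section Specs.
Variable inp : nat -> nat.
Local Notation run := (run inp).
Local Notation eval := (eval inp).

Lemma eval_EEq e1 e2 h : (eval (EEq e1 e2) h != 0) = (eval e1 h == eval e2 h).
Proof. by rewrite /=; lia. Qed.

Lemma eval_ELt e1 e2 h : (eval (ELt e1 e2) h != 0) = (eval e1 h < eval e2 h).
Proof. by rewrite /=; lia. Qed.

Lemma run_if e c1 c2 h :
  run (CIf e c1 c2) h = if eval e h != 0 then run c1 h else run c2 h.
Proof. by []. Qed.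

Lemma run_ifT e c1 c2 h : eval e h != 0 -> run (CIf e c1 c2) h = run c1 h.
Proof. by rewrite run_if => ->. Qed.

Lemma run_ifF e c1 c2 h : eval e h = 0 -> run (CIf e c1 c2) h = run c2 h.
Proof. by rewrite run_if => ->. Qed.

Lemma run_seq c1 c2 h : run (CSeq c1 c2) h = run c2 (run c1 h).
Proof. by []. Qed.

Lemma run_weights h n a b : rv h n_ = n ->
  av h OLD = a -> av h LAB = b ->
  forall v, v < n -> av (run p_weights h) WT v =
    \sum_(x < n) ((a x == a v) && (b x == b v)).
Proof.
move=> hn ha hb; rewrite -hn.
apply: (@run_for inp (fun i g => forall v, v < i -> av g WT v = _)) => //.
move=> u g [fR fA] lt_u gu IH v; rewrite ltnS => le_v.
rewrite run_seq; set g1 := run _ g; rewrite run_seq.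
set g2 := run (CFor _ _ _) g1.
have [fR2 fA2] := frame_run inp _ g1 : frame _ _ g1 g2.
have g2x : rv g2 x_ = \sum_(x < rv h n_) ((a x == a u) && (b x == b u)).
  have <- : rv g1 n_ = rv h n_ by rewrite -fR.
  apply: (@run_for inp (fun i f => rv f x_ = \sum_(x < i) ((a x == a u) && (b x == b u)))) => //.
    by rewrite big_ord0.
  move=> i f [fR3 fA3] lti fi IHf; rewrite !run_if !eval_EEq big_ord_recr /= -IHf fi.
  rewrite !fA3 //= fA // fA // ha hb fR3 //= gu.
  by case: eqP => _; case: eqP => _ //=; lia.
rewrite /= fR2 //= gu g2x fA2 //= /upd.
by case: eqP => [->//|/eqP nv]; apply: IH; rewrite ltn_neqAle nv.
Qed.

Lemma run_links h n a : rv h n_ = n -> av h OLD = a ->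
  forall v, v < n -> av (run p_links h) HD v = last_edge a v n /\
                     av (run p_links h) NX v = last_edge a (a v) v.
Proof.
move=> hn ha; rewrite -hn.
apply: (@run_for inp (fun i g => forall v, v < i ->
  av g HD v = last_edge a v _ /\ av g NX v = last_edge a (a v) v)) => //.
move=> u g [fR fA] lt_u gu IH v; rewrite ltnS => le_v.
rewrite !run_seq; set g1 := run _ (run _ g); set g2 := run (CFor _ _ _) g1.
have gn : rv g1 n_ = rv h n_ by rewrite -fR.
(* The pass for [NX] regards only edges below [u], hence the minimum. *)
suff H x : av g2 HD x = (if x == u then last_edge a u (rv h n_) else av g HD x) /\
    av g2 NX x = (if x == u then last_edge a (a u) (minn (rv h n_) u) else av g NX x).
  have [-> ->] := H v; case: eqP => [->|/eqP vu]; first by rewrite (minn_idPr (ltnW lt_u)).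
  by apply: IH; rewrite ltn_neqAle vu.
move: x; rewrite -gn; apply: (@run_for inp (fun i f => forall x,
    av f HD x = (if x == u then last_edge a u i else av g HD x) /\
    av f NX x = (if x == u then last_edge a (a u) (minn i u) else av g NX x))) => //.
  by move=> x; rewrite /= gu /upd min0n /=; case: eqP.
move=> i f [fR3 fA3] lti fi IHf x; have [H1 H2] := IHf x.
have fu : rv f u_ = u by rewrite fR3.
have fO : av f OLD = a by rewrite fA3 //= fA.
have mi : minn i.+1 u = if i < u then i.+1 else minn i u by case: ltnP; lia.
have C : (eval (EEq (EArr OLD v_) u_) f != 0) = (a i == u).
  by rewrite eval_EEq /= fi fu fO.
rewrite run_seq [X in run _ X]run_if C mi.
by case au: (a i == u); rewrite !run_if eval_EEq eval_ELt /= fi fu fO au;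
  case au': (a i == a u); case: (ltnP i u) H2 => iu H2; rewrite /= /upd ?au' ?H1 ?H2
    ?(minn_idPl (ltnW iu)) ?addn1; split=> //; case: (x == u).
Qed.

Lemma run_init h n : rv h n_ = n ->
  forall i, i < n -> [/\ av (run p_init h) PU i = n, av (run p_init h) PV i = 0,
    av (run p_init h) ML i = 0 & av (run p_init h) MR i = 0].
Proof.
move=> hn; rewrite -hn.
apply: (@run_for inp (fun u g => forall i, i < u -> [/\ av g PU i = _, av g PV i = 0,
    av g ML i = 0 & av g MR i = 0])) => //.
move=> u g [fR fA] lt_u gu IH i; rewrite ltnS => le_i.
rewrite /= gu /upd /= fR //; case: eqP => [//|/eqP iu].
by apply: IH; rewrite ltn_neqAle iu.
Qed.

Definition queue (qs : seq nat) (h : mach) : Prop :=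
  rv h qt_ = size qs /\ forall q, q < size qs -> av h QU q = nth 0 qs q.

Lemma queue_rcons qs h h' x : queue qs h -> rv h' qt_ = (rv h qt_).+1 ->
  av h' QU = upd (av h QU) (rv h qt_) x -> queue (rcons qs x) h'.
Proof.
move=> [H1 H2] E1 E2; split=> [|q]; rewrite size_rcons ?E1 ?H1 //.
rewrite ltnS E2 H1 /upd nth_rcons leq_eqVlt.
by case: eqP => [->|_ /= lq]; [rewrite ltnn | rewrite lq H2].
Qed.

Lemma run_roots h n : rv h n_ = n ->
  let h' := run p_roots h in
  [/\ forall i, i < n -> av h' VR i = 0,
      forall i, i < n -> av h' VL i = (av h ML i == 0),
      queue [seq i <- iota 0 n | av h ML i == 0] h' &
      [/\ rv h' qh_ = 0, rv h' ep_ = 0 & rv h' found_ = 0]].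
Proof.
move=> hn h'.
rewrite {}/h' /p_roots !run_seq; set g := run (CFor _ _ _) _.
suff [H1 H2 H3] : [/\ forall i, i < n -> av g VR i = 0,
      forall i, i < n -> av g VL i = (av h ML i == 0) &
      queue [seq i <- iota 0 n | av h ML i == 0] g] by [].
rewrite {}/g -hn; apply: (@run_for inp (fun u g =>
  [/\ forall i, i < u -> av g VR i = 0,
      forall i, i < u -> av g VL i = (av h ML i == 0) &
      queue [seq i <- iota 0 u | av h ML i == 0] g]) u_ n_ _ (setr h qt_ 0)) => //.
move=> u g [fR fA] lt_u gu [H1 H2 H3].
rewrite -[u.+1]addn1 iotaD filter_cat add0n [filter _ (iota u 1)]/= addn1.
rewrite !run_seq run_if /= gu fA //=.
case: eqP => Mu /=; split.
- move=> i; rewrite ltnS /upd => le; case: eqP => // /eqP iu.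
  by apply: H1; rewrite ltn_neqAle iu.
- move=> i; rewrite ltnS /upd => le; case: eqP => [->|/eqP iu]; first by rewrite Mu.
  by apply: H2; rewrite ltn_neqAle iu.
- by rewrite cats1; apply: queue_rcons H3 _ _; rewrite /= ?addn1 ?gu.
- move=> i; rewrite ltnS /upd => le; case: eqP => // /eqP iu.
  by apply: H1; rewrite ltn_neqAle iu.
- move=> i; rewrite ltnS /upd => le; case: eqP => [->|/eqP iu]; first by case: eqP Mu.
  by apply: H2; rewrite ltn_neqAle iu.
- by rewrite cats0.
Qed.

Section Matching.
Variables (n : nat) (a b w : nat -> nat).
Hypothesis a_lt : forall v, v < n -> a v < n.
Hypothesis b_lt : forall v, v < n -> b v < n.

Record matching_data (h : mach) : Prop := MatchingData {
  md_n : rv h n_ = n;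
  md_n2 : rv h n2_ = n + n;
  md_a : av h OLD = a;
  md_b : av h LAB = b;
  md_w : av h WT = w;
  md_HD : forall v, v < n -> av h HD v = last_edge a v n;
  md_NX : forall v, v < n -> av h NX v = last_edge a (a v) v }.

Lemma matching_data_frame R A h h' : frame R A h h' ->
  ~~ has (mem R) [:: n_; n2_] -> ~~ has (mem A) [:: OLD; LAB; WT; HD; NX] ->
  matching_data h -> matching_data h'.
Proof.
move=> [fR fA] /hasPn nR /hasPn nA [H1 H2 H3 H4 H5 H6 H7].
split; rewrite ?fR ?fA //; by [apply: nR | apply: nA].
Qed.

(** The ranks and the list of scanned edges are ghost data that the program does not store. *)
Definition search_state (U V mL mR : nat -> nat) s (h : mach) : Prop :=
  exists rk qs ls, queue qs h /\
    searching n a b w U V mL mR s (av h VL) (av h VR) rk qs ls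
      (rv h qh_) (rv h ep_) (rv h found_).

Lemma run_step h lv s : matching_data h ->
  hungarian n a b w (av h PU) (av h PV) n lv (av h ML) (av h MR) ->
  search_state (av h PU) (av h PV) (av h ML) (av h MR) s h ->
  search_state (av h PU) (av h PV) (av h ML) (av h MR) s.+1 (run p_step h).
Proof.
move=> [Hn Hn2 Ha Hb Hw HHD HNX] HG [rk [qs [ls [Hq SE]]]].
rewrite /p_step run_if; case: ifP => [f0|/negbT].
  by exists rk, qs, ls; split=> //; apply: search_done SE.
rewrite negbK [eval _ _]/= => /eqP f0; rewrite f0 in SE.
rewrite run_if; case: ifP => [|/negbT]; last first.
  rewrite negbK [eval _ _]/= => /eqP e0; rewrite e0 in SE.
  have [hq1 hq2] := Hq; rewrite run_if eval_ELt /= hq1.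
  case: ltnP => [lt|ge]; last first.
    exists rk, qs, ls; rewrite e0 f0; split=> //; apply: search_idle (SE).
    by apply/eqP; rewrite eqn_leq ge (se_qh SE).
  exists rk, qs, ls; split=> //; rewrite /= f0 addn1 hq2 // HHD; last first.
    by apply: (se_lt SE); rewrite mem_nth.
  exact: search_pop SE.
case Ee: (rv h ep_) => [|v]; rewrite [eval _ _]/= Ee // => _; rewrite Ee in SE.
have [vn qh0 av_] := se_edge SE isT.
rewrite !run_seq; set h1 := run _ h.
have h1x : rv h1 x_ = b v by rewrite /= Ee subn1 /= Hb.
have last_step g : rv g ep_ = v.+1 -> av g NX = av h NX ->
    run (CReg ep_ (EArr NX (EDec ep_))) g = setr g ep_ (last_edge a (a v) v).
  by move=> g1 g2; rewrite /= g1 g2 subn1 /= HNX.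
have C1 : (eval (EEq (EAdd (EArr PU (EArr OLD (EDec ep_))) (EArr PV x_))
    (EArr WT (EDec ep_))) h1 != 0) = tight a b w (av h PU) (av h PV) v.
  by rewrite eval_EEq /= Ee subn1 /= Ha Hb Hw.
rewrite [run (CIf _ _ _) h1]run_if C1; case: ifP => [tv|/negP tv]; last first.
  rewrite last_step //; exists rk, qs, (v :: ls); split=> //=.
  by rewrite f0; apply: search_skip SE _ => // /tv.
rewrite run_if [eval _ _]/= Ee subn1 Hb; case: ifP => [Vb|/negbT].
  rewrite last_step //; exists rk, qs, (v :: ls); split=> //=.
  by rewrite f0; apply: search_skip SE _ => // /tv.
rewrite negbK => /eqP Vb.
rewrite run_seq; set h2 := run _ h1.
have h2x : rv h2 x_ = b v by [].
have h2V : av h2 VR = upd (av h VR) (b v) v.+1 by rewrite /= Ee subn1 /= Hb.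
rewrite run_if [eval _ h2]/= Ee subn1 Hb; case: ifP => [|/negbT].
  case Mb: (av h MR (b v)) => [//|e] _.
  have h2y : av h2 OLD (av h2 MR (rv h2 x_) - 1) = a e.
    by rewrite h2x /= Mb subn1 /= Ha.
  rewrite last_step // !run_seq.
  exists (upd rk (b v) s), (rcons qs (a e)), (v :: ls); split.
    by apply: queue_rcons Hq _ _; rewrite /= ?addn1 // -h2y.
  rewrite /= Ee f0 !subn1 Hb /= Mb Ha.
  exact: (search_mate a_lt b_lt HG SE tv Vb Mb).
rewrite negbK => /eqP Mb; rewrite last_step //.
exists (upd rk (b v) s), qs, (v :: ls); split=> //.
rewrite /= Ee !subn1 Hb /= addn1.
exact: (search_found a_lt b_lt HG SE tv Vb Mb).
Qed.

Lemma run_search h lv : matching_data h ->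
  hungarian n a b w (av h PU) (av h PV) n lv (av h ML) (av h MR) ->
  let h' := run p_search h in
  search_state (av h PU) (av h PV) (av h ML) (av h MR) (n + n) h'.
Proof.
move=> MD HG h'.
pose h1 := run p_roots h.
have [fR fA] : frame _ _ h h1 := frame_run inp p_roots h.
have h1n2 : rv h1 n2_ = n + n by rewrite fR ?(md_n2 MD).
have -> : h' = run (CFor s_ n2_ p_step) h1 by [].
rewrite -[in X in search_state _ _ _ _ X]h1n2.
apply: (@run_for inp (fun i g => search_state _ _ _ _ i g)) => //.
  have [R1 R2 R3 [R4 R5 R6]] := run_roots (md_n MD).
  exists (fun=> 0), [seq i <- iota 0 n | av h ML i == 0], [::]; split=> //.
  rewrite (R4 : rv (setr h1 s_ 0) qh_ = 0) (R5 : rv (setr h1 s_ 0) ep_ = 0).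
  by rewrite (R6 : rv (setr h1 s_ 0) found_ = 0); apply: search_init.
move=> i g gF _ gi Sg.
have [fR2 fA2] := gF.
have E a' : a' \in [:: PU; PV; ML; MR] -> av g a' = av h a'.
  by rewrite !inE => /or4P[]/eqP->; rewrite fA2 // fA.
have MDg : matching_data g.
  apply: (matching_data_frame gF) => //.
  by apply: (matching_data_frame (frame_run inp p_roots h)).
have := @run_step g lv i MDg; rewrite !E //; apply=> //.
Qed.

Definition matched (mL : nat -> nat) := \sum_(i < n) (mL i != 0).

(** Either the hole has been filled, or its rank, which falls with each step, is below the number
    [n + n - t] of steps left. *)
Definition tracing rk (U V : nat -> nat) lv c t g : Prop :=
  (rv g found_ = 0 /\ hungarian n a b w U V n lv (av g ML) (av g MR) /\
     matched (av g ML) = c.+1) \/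
  exists x, [/\ x < n, rv g found_ = x.+1 & av g VR x != 0] /\
    [/\ hungarian n a b w U V x lv (av g ML) (av g MR),
        traceable n a b w U V x (av g ML) (av g VR) rk,
        rk x + t < n + n & matched (av g ML) = c].

Lemma run_augstep h rk U V lv c t : matching_data h ->
  tracing rk U V lv c t h -> tracing rk U V lv c t.+1 (run p_augstep h).
Proof.
move=> MD; rewrite /p_augstep.
case=> [[f0 H]|[x [[xn fx Vx] [HG TR lt cE]]]]; first by rewrite run_ifF //; left.
rewrite run_ifT; last by rewrite /= fx.
have [e [Ve en be te _]] := TR x xn Vx (leqnn _).
have [H1 _ H2 H3] := augment_step a_lt b_lt xn Ve HG TR.
rewrite !run_seq run_if; set g := run _ (run _ _).
have gv : rv g v_ = av h ML (a e).
  by rewrite /= fx !subn1 /= Ve (md_a MD).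
have gML : av g ML = upd (av h ML) (a e) e.+1.
  by rewrite /= fx !subn1 /= Ve (md_a MD).
have gMR : av g MR = upd (av h MR) x e.+1.
  by rewrite /= fx !subn1 /= Ve.
have gVR : av g VR = av h VR by [].
have gLAB : av g LAB = b by rewrite /= (md_b MD).
clearbody g; rewrite [eval _ _]/= gv.
case Me: (av h ML (a e)) H1 H2 H3 => [|e'] H1 H2 H3 /=.
  by left; rewrite gML gMR; split=> //; split=> //; rewrite -cE /matched H2 /= addn1.
have [e'n x'n Vx' rk' TR'] := H3 isT.
right; exists (b e'); rewrite gML gMR gVR gv Me subn1 gLAB addn1; split=> //.
split=> //; first by move: rk' lt => /=; lia.
by rewrite -cE /matched H2 addn0.
Qed.

Lemma run_augment h rk lv c : matching_data h ->
  tracing rk (av h PU) (av h PV) lv c 0 h ->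
  let h' := run p_augment h in
  hungarian n a b w (av h PU) (av h PV) n lv (av h' ML) (av h' MR) /\
  matched (av h' ML) = c.+1.
Proof.
move=> MD T0 h'.
suff : tracing rk (av h PU) (av h PV) lv c (n + n) h'.
  by case=> [[]//|[x [_ [_ _]]]]; lia.
rewrite -(md_n2 MD) /h'.
apply: (@run_for inp (fun i g => tracing _ _ _ _ _ i g)) => //.
move=> i g gF _ gi Tg; apply: run_augstep Tg.
exact: (matching_data_frame gF).
Qed.

Lemma run_adjust h : matching_data h ->
  let h' := run p_adjust h in
  [/\ forall i, i < n -> av h' PU i = av h PU i - (av h VL i != 0),
      forall j, j < n -> av h' PV j = av h PV j + (av h VR j != 0) &
      rv h' h_ = (rv h h_).-1].
Proof.
move=> MD h'; rewrite {}/h' /p_adjust run_seq; set g := run (CFor _ _ _) _.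
have [fR fA] : frame _ _ h g := frame_run inp _ h.
suff H i : av g PU i = (if i < n then av h PU i - (av h VL i != 0) else av h PU i) /\
    av g PV i = (if i < n then av h PV i + (av h VR i != 0) else av h PV i).
  by split=> [i lti|i lti|]; rewrite /= ?subn1 ?fR //; have := H i; rewrite lti => -[].
move: i; rewrite -(md_n MD); apply: (@run_for inp (fun u f => forall i,
    av f PU i = (if i < u then av h PU i - (av h VL i != 0) else av h PU i) /\
    av f PV i = (if i < u then av h PV i + (av h VR i != 0) else av h PV i))) => //.
move=> u f [fR' fA'] ltu fu IH i.
have fVL : av f VL = av h VL by rewrite fA'.
have fVR : av f VR = av h VR by rewrite fA'.
have [E1 E2] := IH u; rewrite ltnn in E1 E2.
rewrite run_seq !run_if /= fu fVL ltnS leq_eqVlt.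
by case Vu: (av h VL u != 0); rewrite /= ?fu fVR; case Wu: (av h VR u != 0);
  rewrite /= /upd ?fu; case: eqP => [->|_] /=; rewrite ?Vu ?Wu ?E1 ?E2 ?subn0 ?addn0 //;
  have [-> ->] := IH i.
Qed.

(** The level plus the number of unmatched left vertices starts at [n + n] and drops in every phase:
    a failed search lowers the level, a successful one enlarges the matching. So [n + n] phases
    bring the level to 0. *)
Definition phase_state r h : Prop :=
  hungarian n a b w (av h PU) (av h PV) n (rv h h_) (av h ML) (av h MR) /\
  (rv h h_ = 0 \/ rv h h_ + (n - matched (av h ML)) + r <= n + n).

Lemma matched_le mL : matched mL <= n.
Proof.
apply: (@leq_trans (\sum_(i < n) 1)); last by rewrite sum_nat_const card_ord muln1.
by apply: leq_sum => i _; apply: leq_b1.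
Qed.

Lemma run_phase h r : matching_data h -> phase_state r h ->
  phase_state r.+1 (run p_phase h).
Proof.
move=> MD [HG pot]; rewrite /p_phase.
have [h0|hN] := eqVneq (rv h h_) 0; first by rewrite run_ifF //; split; auto.
rewrite run_ifT // run_seq; set g := run p_search h.
have [fR fA] : frame _ _ h g := frame_run inp p_search h.
have MDg : matching_data g by apply: (matching_data_frame (frame_run inp p_search h)).
have := run_search MD HG; rewrite -/g -!fA //.
rewrite -!fA // -(fR h_) // in HG pot hN; case: pot => [E|pot]; first by rewrite E in hN.
case=> rk [qs [ls [_ SE]]].
have [f0|fN] := eqVneq (rv g found_) 0.
  rewrite run_ifF //; have [A1 A2 A3] := run_adjust MDg.
  set f := run p_adjust g in A1 A2 A3 *.
  have [fR2 fA2] : frame _ _ g f := frame_run inp p_adjust g.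
  rewrite /phase_state A3 !(fA2 ML, fA2 MR) //; split; last by right; lia.
  rewrite f0 in SE; rewrite -[rv g h_]prednK ?lt0n // in HG.
  apply: hungarian_adjust HG (se_forest SE) _ _ A1 A2 => //.
    exact: se_mate SE _.
  exact: search_end SE.
rewrite run_ifT //.
case fE: (rv g found_) fN => [//|x] _; rewrite fE in SE.
have [xn Vx Mx] := se_found SE erefl.
have T0 : tracing rk (av g PU) (av g PV) (rv g h_) (matched (av g ML)) 0 g.
  right; exists x; split=> //; split=> //.
  - exact: hungarian_hole HG.
  - exact: forest_traceable (se_forest SE).
  - rewrite addn0; case Ve: (av g VR x) Vx => [//|e] _.
    by have [] := fo_rank (se_forest SE) xn Ve.
have [H1 H2] := run_augment MDg T0; set f := run p_augment g in H1 H2 *.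
have [fR2 fA2] : frame _ _ g f := frame_run inp p_augment g.
rewrite /phase_state (fA2 PU) // (fA2 PV) // (fR2 h_) //; split=> //; right.
(* The matching cannot exceed [n], so the truncated difference really drops. *)
have := matched_le (av f ML); lia.
Qed.

Hypothesis wE : forall v, v < n ->
  w v = \sum_(x < n) ((a x == a v) && (b x == b v)).

Lemma run_matching h : matching_data h ->
  let h' := run p_matching h in
  exists mL mR, hungarian n a b w (av h' PU) (av h' PV) n 0 mL mR.
Proof.
move=> MD h'; pose g := run p_init h; pose f := setr g h_ n.
have Hi := run_init (md_n MD); rewrite -/g in Hi.
have [fR fA] : frame _ _ h g := frame_run inp p_init h.
have gn : rv g n_ = n by rewrite fR // (md_n MD).
have h'E : h' = run (CFor r_ n2_ p_phase) f.
  by rewrite /f -[X in setr g _ X]gn.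
have MDg : matching_data g by apply: (matching_data_frame (frame_run inp p_init h)).
have MDf : matching_data f by case: MDg.
have HG0 : hungarian n a b w (av f PU) (av f PV) n n (av f ML) (av f MR).
  by apply: hungarian_init => // i lti; case: (Hi i lti).
have : phase_state (n + n) h'.
  rewrite -(md_n2 MDf) h'E; apply: (@run_for inp (fun i g => phase_state i g)) => //.
    by split=> //; right=> /=; lia.
  move=> i g' gF _ gi; apply: run_phase; exact: (matching_data_frame gF).
case=> HG pot; exists (av h' ML), (av h' MR).
by case: (rv h' h_) HG pot => [//|lv] HG [//|]; lia.
Qed.

End Matching.

Lemma run_value h n : rv h n_ = n ->
  rv (run p_value h) val_ = \sum_(i < n) av h PU i + \sum_(j < n) av h PV j.
Proof.
move=> hn; rewrite -big_split -hn /p_value run_seq.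
apply: (@run_for inp (fun u g => rv g val_ = \sum_(i < u) (av h PU i + av h PV i))
  u_ n_ _ (setr h val_ 0)) => //; first by rewrite big_ord0.
by move=> u g [fR fA] ltu gu IH; rewrite big_ord_recr /= -IH gu !fA.
Qed.

(** [ok_] is only ever switched on, so repeated tests compute a disjunction. *)
Lemma run_compatible h n a : rv h n_ = n -> rv h n2_ = n + n ->
  (forall u, u < n -> av h LST (rv h p_ + u) = a u /\ a u < n) ->
  (forall u, u < n -> av h LAB u < n) ->
  rv (run p_compatible h) ok_ != 0 <->
  rv h ok_ != 0 \/ compatible (rv h dd_) (clusters n a) (clusters n (av h LAB)).
Proof.
move=> hn hn2 aE b_lt; rewrite /p_compatible run_seq; set g1 := run _ h.
have [fR1 fA1] : frame _ _ h g1 := frame_run inp _ h.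
have g1a u : u < n -> av g1 OLD u = a u.
  move: u; rewrite -hn.
  apply: (@run_for inp (fun i g => forall u, u < i -> av g OLD u = a u)) => //.
  move=> u g [fR fA] ltu gu IH v; rewrite ltnS /= gu /upd fA // fR //= => le.
  case: eqP => [->|/eqP vu]; first by case: (aE u); rewrite -?hn.
  by apply: IH; rewrite ltn_neqAle vu.
have a_lt u : u < n -> av g1 OLD u < n by move=> un; rewrite g1a //; case: (aE u un).
have Eb : av g1 LAB = av h LAB by rewrite fA1.
rewrite run_seq; set g2 := run _ g1; rewrite run_seq; set g3 := run _ g2.
have [fR2 fA2] : frame _ _ g1 g2 := frame_run inp _ g1.
have [fR3 fA3] : frame _ _ g2 g3 := frame_run inp _ g2.
have wE v : v < n -> av g3 WT v =
    \sum_(x < n) ((av g1 OLD x == av g1 OLD v) && (av g1 LAB x == av g1 LAB v)).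
  by move=> vn; rewrite fA3 // (run_weights (n := n) _ erefl erefl) // fR1.
have links v : v < n -> av g3 HD v = last_edge (av g1 OLD) v n /\
    av g3 NX v = last_edge (av g1 OLD) (av g1 OLD v) v.
  by apply: run_links; rewrite ?fA2 ?fR2 ?fR1.
have MD : matching_data n (av g1 OLD) (av g1 LAB) (av g3 WT) g3.
  split=> //; [| | | |by move=> v /links[]|by move=> v /links[]].
  - by rewrite fR3 // fR2 // fR1.
  - by rewrite fR3 // fR2 // fR1.
  - by rewrite fA3 // fA2.
  - by rewrite fA3 // fA2.
have b_lt1 v : v < n -> av g1 LAB v < n by rewrite Eb; apply: b_lt.
have [mL [mR HG]] := run_matching a_lt b_lt1 wE MD.
rewrite run_seq; set g4 := run _ g3 in HG *; rewrite run_seq; set g5 := run _ g4.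
have [fR4 fA4] : frame _ _ g3 g4 := frame_run inp _ g3.
have [fR5 fA5] : frame _ _ g4 g5 := frame_run inp _ g4.
have RE x : x \in [:: n_; dd_; ok_] -> rv g5 x = rv h x.
  by rewrite !inE => /or3P[]/eqP->; rewrite fR5 // fR4 // fR3 // fR2 // fR1.
have g5v : rv g5 val_ = \sum_(i < n) av g4 PU i + \sum_(j < n) av g4 PV j.
  by apply: run_value; rewrite fR4 // fR3 // fR2 // fR1.
have opt := optimumP a_lt b_lt1 wE HG (rv h dd_).
have cE : compatible (rv h dd_) (clusters n a) (clusters n (av h LAB)) <->
    n <= rv h dd_ + rv g5 val_.
  rewrite g5v; apply: (iff_trans _ (iff_sym opt)).
  have -> : clusters n a = clusters n (av g1 OLD).
    by apply: eq_edges_of => u v un vn _; rewrite !g1a.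
  by rewrite -Eb; apply: compatible_clusters.
rewrite run_if /= (RE n_) // (RE dd_) // hn subn_eq0; case: leqP => le /=.
  by split=> // _; right; apply/cE.
rewrite (RE ok_) //; split; first by left.
by case=> // /cE; rewrite leqNgt le.
Qed.

End Specs.

(** * The main program *)

(** With truncated subtraction, [k - (k - n * n)] is the minimum of [k] and [n * n]. *)
Definition p_size : cmd :=
  CReg nn_ (ECst 0);;
  CFor u_ n_ (CReg nn_ (EAdd nn_ n_));;
  CReg n2_ (EAdd n_ n_);;
  CReg kk_ (ESub k_ (ESub k_ nn_));;
  CReg k2_ (EAdd kk_ kk_).

Definition p_count : cmd :=
  CReg P_ (ECst 1);;
  CFor u_ k2_ (
    CReg x_ (ECst 0);;
    CFor v_ n_ (CReg x_ (EAdd x_ P_));;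
    CReg P_ x_).

(** The table of row offsets lets [cell] address a matrix in constant time. *)
Definition p_rows : cmd :=
  CReg x_ (ECst 0);;
  CFor u_ n_ (CArr ROW u_ x_;; CReg x_ (EAdd x_ n_)).

(** Arrays start out zero, so the first [n] entries of [LST] already hold the labels of the dummy
    layer, a single clique. *)
Definition p_setup : cmd :=
  CReg hi_ n_;; CReg cnt_ (ECst 1);; CReg dd_ n_.

Definition p_load : cmd := CFor u_ nn_ (CArr ADJ u_ (EInp (EAdd off_ u_))).

Definition cell x y := EAdd (EArr ROW x) y.

Definition p_toggle : cmd :=
  CFor s_ kk_ (
    CReg x_ (EArr DIG (EAdd s_ s_));;
    CReg y_ (EArr DIG (EInc (EAdd s_ s_)));;
    CIf (EEq x_ y_) CSkip
      (CArr ADJ (cell x_ y_) (ESub (ECst 1) (EArr ADJ (cell x_ y_)));;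
       CArr ADJ (cell y_ x_) (ESub (ECst 1) (EArr ADJ (cell y_ x_))))).

Definition p_labels : cmd :=
  CFor u_ n_ (
    CReg x_ u_;;
    CFor v_ n_ (CIf (EArr ADJ (cell u_ v_))
      (CIf (ELt v_ x_) (CReg x_ v_) CSkip) CSkip);;
    CArr LAB u_ x_).

Definition p_check : cmd :=
  CReg good_ (ECst 1);;
  CFor u_ n_ (CFor v_ n_ (
    CIf (EEq u_ v_) CSkip
      (CIf (EEq (EArr LAB u_) (EArr LAB v_))
        (CIf (EArr ADJ (cell u_ v_)) CSkip (CReg good_ (ECst 0)))
        (CIf (EArr ADJ (cell u_ v_)) (CReg good_ (ECst 0)) CSkip)))).

(** The loop runs to [P_] with a guard, because [cnt_] changes from layer to layer and cannot bound
    a loop. *)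
Definition p_previous : cmd :=
  CReg ok_ (ECst 0);;
  CReg p_ lo_;;
  CFor e_ P_ (CIf (ELt e_ cnt_)
    (p_compatible;; CReg p_ (EAdd p_ n_)) CSkip).

Definition p_append : cmd :=
  CFor u_ n_ (CArr LST (EAdd hi_ u_) (EArr LAB u_));;
  CReg hi_ (EAdd hi_ n_);;
  CReg new_ (EInc new_).

Definition p_next : cmd :=
  CReg carry_ (ECst 1);;
  CFor u_ k2_ (CIf carry_
    (CIf (ELt (EInc (EArr DIG u_)) n_)
      (CArr DIG u_ (EInc (EArr DIG u_));; CReg carry_ (ECst 0))
      (CArr DIG u_ (ECst 0)))
    CSkip).

Definition p_candidate : cmd :=
  p_load;; p_toggle;; p_labels;; p_check;;
  CIf good_ (p_previous;; CIf ok_ p_append CSkip) CSkip;;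
  p_next.

(** After [P_] increments the digits have wrapped around to zero, ready for the next layer. *)
Definition p_layer : cmd :=
  CReg new_ (ECst 0);;
  CReg st_ hi_;;
  CFor m_ P_ p_candidate;;
  CReg lo_ st_;; CReg cnt_ new_;;
  CReg off_ (EAdd off_ nn_);; CReg dd_ d_.

Definition p_main : cmd := p_setup;; CFor i_ l_ p_layer;; CReg n_ cnt_.

Lemma row_major_inj n u v u' v' : v < n -> v' < n ->
  (u * n + v == u' * n + v') = (u == u') && (v == v').
Proof.
move=> vn vn'; apply/eqP/andP => [E|[/eqP-> /eqP->]//].
have n0 : 0 < n by apply: leq_ltn_trans vn.
have := congr1 (divn^~ n) E; rewrite /= !divnMDl // !divn_small // !addn0 => Eu.
by move: E; rewrite Eu => /addnI->.
Qed.

(** * Specifications of the pieces of the main program *)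

Section Specs.
Variable inp : nat -> nat.
Local Notation run := (run inp).
Local Notation eval := (eval inp).

Lemma run_size h n k : rv h n_ = n -> rv h k_ = k ->
  let h' := run p_size h in
  [/\ rv h' nn_ = n * n, rv h' n2_ = n + n, rv h' kk_ = minn k (n * n) &
      rv h' k2_ = minn k (n * n) + minn k (n * n)].
Proof.
move=> hn hk h'; pose g := run (CFor u_ n_ (CReg nn_ (EAdd nn_ n_))) (setr h nn_ 0).
have [fR fA] : frame _ _ (setr h nn_ 0) g := frame_run inp _ _.
have gnn : rv g nn_ = n * n.
  rewrite -[X in _ = X * _]hn; apply: (@run_for inp (fun i f => rv f nn_ = i * n)
    u_ n_ _ (setr h nn_ 0)) => //.
  by move=> i f [fR' fA'] lti fi IH; rewrite /= IH fR' //= hn mulSnr.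
have -> : h' = run (CReg n2_ (EAdd n_ n_);; CReg kk_ (ESub k_ (ESub k_ nn_));;
  CReg k2_ (EAdd kk_ kk_)) g by [].
clearbody g; rewrite /= gnn !fR //= hn hk; split=> //; lia.
Qed.

Lemma run_count h n : rv h n_ = n -> rv (run p_count h) P_ = n ^ rv h k2_.
Proof.
move=> hn; rewrite /p_count run_seq.
apply: (@run_for inp (fun i g => rv g P_ = n ^ i) u_ k2_ _ (setr h P_ 1)) => //.
move=> i g [fR fA] lti gi IH; rewrite run_seq; set g1 := run _ g.
rewrite run_seq; set g2 := run _ g1; rewrite [LHS]/=.
have gn : rv g1 n_ = n by rewrite /= fR.
rewrite expnS -[X in _ = X * _]gn.
apply: (@run_for inp (fun i f => rv f x_ = i * n ^ _)) => //.
by move=> j f [fR' fA'] ltj fj IHf; rewrite /= IHf fR' //= IH mulSnr.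
Qed.

Section Graph.
Variable n : nat.

Definition rows h := forall u, u < n -> av h ROW u = u * n.
Definition adjacency (r : rel nat) h :=
  forall u v, u < n -> v < n -> av h ADJ (u * n + v) = r u v.

Lemma run_rows h : rv h n_ = n -> rows (run p_rows h).
Proof.
move=> hn; suff [_] : rv (run p_rows h) x_ = rv h n_ * n /\
  forall u, u < rv h n_ -> av (run p_rows h) ROW u = u * n by rewrite hn.
rewrite /p_rows run_seq; apply: (@run_for inp (fun i f => rv f x_ = i * n /\
  forall u, u < i -> av f ROW u = u * n) u_ n_ _ (setr h x_ 0)) => //.
move=> i f [fR fA] lti fi [H1 H2]; rewrite /= H1 fR //= hn mulSnr; split=> // u.
rewrite ltnS /upd fi => le; case: eqP => [->//|/eqP ui].
by apply: H2; rewrite ltn_neqAle ui.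
Qed.

Lemma run_load h (r : rel nat) : rv h nn_ = n * n ->
  (forall u v, u < n -> v < n -> inp (rv h off_ + (u * n + v)) = r u v :> nat) ->
  adjacency r (run p_load h).
Proof.
move=> hnn H.
have L i : i < n * n -> av (run p_load h) ADJ i = inp (rv h off_ + i).
  move: i; rewrite -hnn; apply: (@run_for inp (fun i g => forall j, j < i ->
    av g ADJ j = inp (rv h off_ + j))) => //.
  move=> i g [fR fA] lti gi IH j; rewrite ltnS /= /upd gi fR // => le.
  by case: eqP => [->//|/eqP ji]; apply: IH; rewrite ltn_neqAle ji.
move=> u v un vn; rewrite L ?H //.
apply: (@leq_trans (u.+1 * n)); first by rewrite mulSnr ltn_add2l.
by rewrite leq_mul2r un orbT.
Qed.

Lemma run_toggle h r : rows h ->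
  (forall j, j < rv h kk_ + rv h kk_ -> av h DIG j < n) -> adjacency r h ->
  adjacency (fun u v => r u v (+) toggles (av h DIG) (rv h kk_) u v) (run p_toggle h).
Proof.
move=> hR hD hA.
apply: (@run_for inp (fun i g =>
  adjacency (fun u v => r u v (+) toggles (av h DIG) i u v) g)) => //.
  by move=> u v un vn; rewrite addbF; apply: hA.
move=> i g [fR fA] lti gi IH u v un vn.
have xn : av h DIG (i + i) < n by apply: hD; lia.
have yn : av h DIG (i + i).+1 < n by apply: hD; lia.
set x := av h DIG (i + i) in xn; set y := av h DIG (i + i).+1 in yn.
rewrite run_seq; set g1 := run _ g; rewrite run_seq; set g2 := run _ g1.
have g2x : rv g2 x_ = x by rewrite /= gi fA.
have g2y : rv g2 y_ = y by rewrite /= gi fA // addn1.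
have g2R : av g2 ROW = av h ROW by rewrite /= fA.
have g2A : av g2 ADJ = av g ADJ by [].
clearbody g2.
have C : (eval (EEq x_ y_) g2 != 0) = (x == y) by rewrite eval_EEq /= g2x g2y.
rewrite run_if C /= -/x -/y /toggle_pair.
case: eqP => [_|/eqP xy] /=; first by rewrite addbF g2A IH.
rewrite g2x g2y g2R g2A !hR // /upd !row_major_inj //.
(* As [x] and [y] differ, the two cells are distinct and the second flip does not undo the first. *)
rewrite (negPf xy) andbF; case: ifP => [/andP[/eqP-> /eqP->]|_].
  by rewrite IH // orbT addbA addbT; case: (_ (+) _).
case: ifP => [/andP[/eqP-> /eqP->]|_]; last by rewrite addbF IH.
by rewrite IH // addbA addbT; case: (_ (+) _).
Qed.

Lemma run_labels h r : rv h n_ = n -> rows h -> adjacency r h ->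
  let F := av (run p_labels h) LAB in
  forall u, u < n -> [/\ F u < n, F u = u \/ r u (F u), F u <= u &
     forall v, v < n -> r u v -> F u <= v].
Proof.
move=> hn hR hA F.
pose I i (F : nat -> nat) u := [/\ F u < n, F u = u \/ r u (F u), F u <= u &
     forall v, v < i -> r u v -> F u <= v].
suff : forall u, u < rv h n_ -> I n F u by rewrite hn.
apply: (@run_for inp (fun i g => forall u, u < i -> I n (av g LAB) u)) => //.
move=> i g [fR fA] lti gi IH u; rewrite ltnS => le.
rewrite run_seq; set g1 := run _ g; rewrite run_seq; set g2 := run _ g1.
have [fR2 fA2] : frame _ _ g1 g2 := frame_run inp _ g1.
suff Ii : I n (fun=> rv g2 x_) i.
  have -> : av (setr (run (CArr LAB u_ x_) g2) u_ i.+1) LAB = upd (av g LAB) i (rv g2 x_).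
    by rewrite /= fR2 //= gi fA2.
  have [->|ui] := eqVneq u i; first by rewrite /I /upd eqxx.
  by rewrite /I /upd (negPf ui); apply: IH; rewrite ltn_neqAle ui.
rewrite hn in lti; have g1n : rv g1 n_ = n by rewrite /= fR.
rewrite -{1}g1n; apply: (@run_for inp (fun j f => I j (fun=> rv f x_) i)) => //.
  by rewrite /I /= gi; split=> //; left.
move=> j f [fR3 fA3] ltj fj [I1 I2 I3 I4].
rewrite g1n in ltj.
have fc : eval (EArr ADJ (cell u_ v_)) f = r i j.
  by rewrite /= fR3 //= gi fj !fA3 //= !fA // hR // hA.
rewrite run_if fc; case rij: (r i j); rewrite /= ?fj; last first.
  split=> // v; rewrite ltnS leq_eqVlt => /orP[/eqP->|]; first by rewrite rij.
  exact: I4.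
rewrite subn_eq0 -ltnNge; case: ltnP => lt /=; rewrite ?fj; split=> //.
- by right.
- exact: leq_trans (ltnW lt) I3.
- move=> v; rewrite ltnS leq_eqVlt => /orP[/eqP->//|vj rv].
  exact: leq_trans (ltnW lt) (I4 _ vj rv).
- move=> v; rewrite ltnS leq_eqVlt => /orP[/eqP->//|vj rv]; exact: I4.
Qed.

Lemma run_check h (r : rel nat) : rv h n_ = n -> rows h -> adjacency r h ->
  rv (run p_check h) good_ != 0 <->
  (forall u v, u < n -> v < n -> u != v -> r u v = (av h LAB u == av h LAB v)).
Proof.
move=> hn hR hA; rewrite -{1}hn /p_check run_seq.
pose ok u v := u != v -> r u v = (av h LAB u == av h LAB v).
apply: (@run_for inp (fun i g => rv g good_ != 0 <->
  forall u v, u < i -> v < n -> ok u v) u_ n_ _ (setr h good_ 1)) => //.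
move=> i g [fR fA] lti gi IH; have {}lti : i < n by rewrite -hn.
have gn : rv g n_ = n by rewrite fR.
set g2 := run _ g.
suff H : rv g2 good_ != 0 <-> rv g good_ != 0 /\ forall v, v < n -> ok i v.
  rewrite [rv (setr _ _ _) _]/=; split.
    move=> /H[/IH H1 H2] u v; rewrite ltnS leq_eqVlt => /orP[/eqP->|]; auto.
  move=> H1; apply/H; split=> [|v vn]; last exact: H1.
  by apply/IH => u v ui; apply: H1; apply: ltnW.
rewrite -gn; apply: (@run_for inp (fun j f => rv f good_ != 0 <->
   rv g good_ != 0 /\ forall v, v < j -> ok i v)) => //.
  by split=> [|[]].
move=> j f [fR3 fA3] ltj fj IHf; rewrite gn in ltj.
have fi : rv f u_ = i by rewrite fR3.
have fc : eval (EArr ADJ (cell u_ v_)) f = r i j.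
  by rewrite /= fi fj !fA3 //= !fA // hR // hA.
have fL : av f LAB = av h LAB by rewrite fA3 // fA.
set b := run _ f; suff Hb : rv b good_ != 0 <-> rv f good_ != 0 /\ ok i j.
  rewrite [rv (setr _ _ _) _]/=; split.
    case/Hb=> /IHf[H1 H2] H3; split=> // v; rewrite ltnS leq_eqVlt => /orP[/eqP->//|]; exact: H2.
  move=> [H1 H2]; apply/Hb; split; last exact: H2.
  by apply/IHf; split=> // v vj; apply: H2; apply: ltnW.
have C : (eval (EEq u_ v_) f != 0) = (i == j) by rewrite eval_EEq /= fi fj.
have CL : (eval (EEq (EArr LAB u_) (EArr LAB v_)) f != 0) =
    (av h LAB i == av h LAB j) by rewrite eval_EEq /= fi fj fL.
rewrite /b run_if C /ok; case: (i =P j) => ij; first by split=> [gd|[]//]; split.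
rewrite run_if CL; case: (av h LAB i == av h LAB j); rewrite run_if fc; case: (r i j) => /=.
- by split=> [gd|[]//]; split.
- by split=> // -[_ /(_ isT)].
- by split=> // -[_ /(_ isT)].
- by split=> [gd|[]//]; split.
Qed.


Lemma run_previous h : rv h n_ = n -> rv h n2_ = n + n -> rv h cnt_ <= rv h P_ ->
  (forall u, u < n -> av h LAB u < n) ->
  (forall e u, e < rv h cnt_ -> u < n -> av h LST (rv h lo_ + e * n + u) < n) ->
  rv (run p_previous h) ok_ != 0 <->
  exists2 e, e < rv h cnt_ & compatible (rv h dd_)
    (clusters n (fun u => av h LST (rv h lo_ + e * n + u))) (clusters n (av h LAB)).
Proof.
move=> hn hn2 hP hL hE; set C := fun e => compatible _ (clusters n (fun u => _ (_ + e * n + u))) _.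
pose g0 := setr (setr h ok_ 0) p_ (rv h lo_).
rewrite /p_previous !run_seq; set F := run _ _.
suff [_] : rv F p_ = rv h lo_ + minn (rv g0 P_) (rv h cnt_) * n /\
    (rv F ok_ != 0 <-> exists2 e, e < minn (rv g0 P_) (rv h cnt_) & C e).
  by rewrite (minn_idPr hP).
apply: (@run_for inp (fun i g => rv g p_ = rv h lo_ + minn i (rv h cnt_) * n /\
    (rv g ok_ != 0 <-> exists2 e, e < minn i (rv h cnt_) & C e)) e_ P_ _ g0) => //.
  by rewrite min0n mul0n addn0; split=> //; split=> // -[].
move=> i g [fR fA] lti gi [IH1 IH2].
have gc : rv g cnt_ = rv h cnt_ by rewrite fR.
have Cc : (eval (ELt e_ cnt_) g != 0) = (i < rv h cnt_) by rewrite eval_ELt /= gi gc.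
rewrite run_if Cc; case: ltnP => lt; last first.
  by rewrite (minn_idPr (leqW lt)); rewrite (minn_idPr lt) in IH1 IH2.
rewrite (minn_idPl lt); rewrite (minn_idPl (ltnW lt)) in IH1 IH2.
rewrite run_seq; set g1 := run _ g.
have [fR1 fA1] : frame _ _ g g1 := frame_run inp p_compatible g.
have Ep : rv g1 p_ = rv h lo_ + i * n by rewrite fR1.
have En : rv g1 n_ = n by rewrite fR1 // fR.
have EL : av g LAB = av h LAB by rewrite fA.
have ET : av g LST = av h LST by rewrite fA.
have := @run_compatible inp g n (fun u => av h LST (rv h lo_ + i * n + u)).
rewrite -/g1 EL ET IH1 (fR dd_) // (fR n_) // (fR n2_) // => /(_ hn hn2) [||H1 H2].
- by move=> u un; split=> //; apply: hE.
- exact: hL.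
split; first by rewrite /= Ep En mulSn; lia.
rewrite [rv _ ok_]/=; split=> [/H1[/IH2[e ei Ce]|Ci]|[e]].
- by exists e => //; apply: leqW.
- by exists i.
rewrite ltnS leq_eqVlt => /orP[/eqP->|ei] Ce; apply: H2; first by right.
by left; apply/IH2; exists e.
Qed.

Lemma run_append h : rv h n_ = n ->
  let h' := run p_append h in
  [/\ forall x, av h' LST x =
        if rv h hi_ <= x < rv h hi_ + n then av h LAB (x - rv h hi_) else av h LST x,
      rv h' hi_ = rv h hi_ + n & rv h' new_ = (rv h new_).+1].
Proof.
move=> hn h'; pose g := run (CFor u_ n_ (CArr LST (EAdd hi_ u_) (EArr LAB u_))) h.
have [fR fA] : frame _ _ h g := frame_run inp _ h.
have gL x : av g LST x =
    if rv h hi_ <= x < rv h hi_ + n then av h LAB (x - rv h hi_) else av h LST x.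
  move: x; rewrite -[X in _ + X]hn.
  apply: (@run_for inp (fun i f => forall x, av f LST x =
    if rv h hi_ <= x < rv h hi_ + i then av h LAB (x - rv h hi_) else av h LST x)) => //.
    by move=> x; rewrite addn0 ltnNge andbN.
  move=> i f [fR' fA'] lti fi IH x; rewrite /= fi fR' // (fA' LAB) // /upd.
  case: eqP => [->|/eqP nx]; first by rewrite leq_addr addnS leqnn addKn.
  by rewrite IH addnS ltnS [x <= _]leq_eqVlt (negPf nx).
have -> : h' = run (CReg hi_ (EAdd hi_ n_);; CReg new_ (EInc new_)) g by [].
by clearbody g; rewrite /= addn1 !fR //= hn.
Qed.

Definition digits (m : nat) (h : mach) :=
  forall j, j < rv h k2_ -> av h DIG j = m %/ n ^ j %% n.

(* The carry reaches position [j] iff [n ^ j] divides the successor of [m]. *)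
Lemma run_next m h : 0 < n -> rv h n_ = n -> digits m h -> digits m.+1 (run p_next h).
Proof.
move=> n0 hn dm.
pose I i g := rv g carry_ = (n ^ i %| m.+1) /\ forall j, j < rv h k2_ ->
   av g DIG j = (if j < i then m.+1 else m) %/ n ^ j %% n.
suff [_ H] : I (rv h k2_) (run p_next h).
  move=> j; have [fR _] := frame_run inp p_next h.
  by rewrite fR // => lt; rewrite H // lt.
rewrite /p_next run_seq; apply: (@run_for inp I u_ k2_ _ (setr h carry_ 1)) => //.
  by split=> [|j lt]; rewrite ?expn0 ?dvd1n // ltn0; apply: dm.
move=> i g [fR fA] lti gi [IH1 IH2].
have gn : rv g n_ = n by rewrite fR.
have {}lti : i < rv h k2_ by [].
have Di : av g DIG i = m %/ n ^ i %% n by rewrite IH2 // ltnn.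
have ni : 0 < n ^ i by rewrite expn_gt0 n0.
have step : n ^ i.+1 %| m.+1 = (n ^ i %| m.+1) && (n %| m.+1 %/ n ^ i).
  case: (boolP (n ^ i %| m.+1)) => /= [/dvdnP[q ->]|nd].
    by rewrite mulnK // expnS dvdn_pmul2r.
  by apply/negP => H; case/negP: nd; apply: dvdn_trans H; rewrite expnS dvdn_mull.
have splitj D' : D' = m.+1 %/ n ^ i %% n -> forall j, j < rv h k2_ ->
    upd (av g DIG) i D' j = (if j < i.+1 then m.+1 else m) %/ n ^ j %% n.
  move=> -> j lt; rewrite /upd ltnS leq_eqVlt; case: eqP => [->//|_] /=; exact: IH2.
set q := m %/ n ^ i in Di; rewrite divnS // -/q in step splitj.
have next : ((q %% n).+1 < n) = ~~ (n %| q.+1).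
  have := modnS q n; case: ifP => nq eq /=; last by rewrite -eq ltn_mod.
  apply/negbTE; rewrite -leqNgt; apply: dvdn_leq => //.
  by rewrite -addn1 /dvdn modnDml addn1.
have C : (eval (ELt (EInc (EArr DIG u_)) n_) g != 0) = ~~ (n %| q.+1).
  by rewrite eval_ELt /= gi gn Di addn1 next.
case: (boolP (n ^ i %| m.+1)) IH1 step splitj => nd IH1 step splitj.
  rewrite run_ifT; last by rewrite /= IH1.
  rewrite run_if C; rewrite /= add1n in step splitj.
  case: (boolP (n %| q.+1)) step => nq step /=; (split; first by rewrite /= ?IH1 step).
    by move=> j lt; rewrite /= gi; apply: splitj => //; rewrite modnS nq.
  by move=> j lt; rewrite /= gi Di addn1; apply: splitj => //; rewrite modnS (negPf nq).
rewrite run_ifF //; split; first by rewrite /= IH1 step.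
move=> j lt; rewrite /= -(splitj _ erefl) // add0n -Di /upd.
by case: eqP => [->|].
Qed.

End Graph.
End Specs.

(** * Correctness *)

Lemma digits_exist n K (dg : nat -> nat) : (forall j, j < K -> dg j < n) ->
  exists2 m, m < n ^ K & forall j, j < K -> m %/ n ^ j %% n = dg j.
Proof.
elim: K => [|K IH] H; first by exists 0.
have [j jK|m mK Hm] := IH; first by apply: H; apply: leqW.
have dn := H K (leqnn _); have n0 : 0 < n by apply: leq_ltn_trans dn.
have nK : 0 < n ^ K by rewrite expn_gt0 n0.
exists (m + dg K * n ^ K).
  by rewrite expnS; apply: (@leq_trans ((dg K).+1 * n ^ K));
    [rewrite mulSn ltn_add2r | rewrite leq_mul2r dn orbT].
move=> j; rewrite ltnS leq_eqVlt => /orP[/eqP->|jK].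
  by rewrite addnC divnMDl // divn_small // addn0 modn_small.
rewrite addnC -(subnK (ltnW jK)) expnD mulnA divnMDl ?expn_gt0 ?n0 //.
by rewrite -(subnSK jK) expnSr mulnA modnMDl Hm.
Qed.

Section Solve.
Variables (n l k d : nat) (G : temporal_graph 'I_n l) (inp : nat -> nat).
Hypothesis inpE : forall (i : 'I_l) (u v : 'I_n),
  inp (i * (n * n) + (u * n + v)) = ([set u; v] \in edges (G i)).
Local Notation run := (run inp).

Local Notation K := (minn k (n * n)).
Local Notation NP := (n ^ (K + K)).

Definition layer i : rel nat := fun u v => inp (i * (n * n) + (u * n + v)) != 0.
Definition candidate i m : rel nat := fun u v =>
  layer i u v (+) toggles (fun j => m %/ n ^ j %% n) K u v.
Local Notation gr i m := (edges_of n (candidate i m)).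

Lemma layerE (i : 'I_l) (u v : 'I_n) : layer i u v = ([set u; v] \in edges (G i)).
Proof. by rewrite /layer inpE; case: (_ \in _). Qed.

Lemma sym_layer i : i < l -> sym_on n (layer i).
Proof.
move=> lti u v un vn.
have := layerE (Ordinal lti) (Ordinal un) (Ordinal vn); rewrite /= => ->.
by have := layerE (Ordinal lti) (Ordinal vn) (Ordinal un); rewrite /= setUC => ->.
Qed.

Lemma edges_layer (i : 'I_l) : edges_of n (layer i) = edges (G i).
Proof.
apply: eq_edges => [||u v uv]; [exact: edges_of_pairs|exact: edges_pairs|].
by rewrite mem_edges_of ?uv ?layerE //; apply: sym_layer.
Qed.

Lemma sym_candidate i m : i < l -> sym_on n (candidate i m).
Proof.
move=> lti u v un vn; rewrite /candidate (sym_layer lti) //.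
by rewrite (@sym_toggles n _ _ u v).
Qed.

Lemma gr_symdiff (i : 'I_l) m : gr i m = symdiff (edges (G i))
  (edges_of n (toggles (fun j => m %/ n ^ j %% n) K)).
Proof.
by rewrite -edges_layer symdiff_edges_of //; [apply: sym_layer|apply: sym_toggles].
Qed.

(** An edit set has at most [n * n] elements, so the cap on [K] loses none, and [digits_exist] turns
    the ends of its pairs into a number. *)
Lemma layer_clusteringP i E : i < l -> layer_clustering G k i E <->
  exists2 m, m < NP & cluster_graph (gr i m) /\ E = gr i m.
Proof.
move=> lti; split=> [[j [M [ji sM leM -> cE]]]|[m mP [cE ->]]]; last first.
  exists (Ordinal lti), (edges_of n (toggles (fun j => m %/ n ^ j %% n) K)).
  rewrite -gr_symdiff; split=> //; first exact: edges_of_pairs.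
  have [->|n0] := posnP n.
    by rewrite muln0 minn0; apply: leq_trans (leq0n _); rewrite leqn0 cards_eq0;
      apply/eqP/setP=> e; rewrite !inE; apply/existsP=> -[[]].
  apply: leq_trans (geq_minl k (n * n)); apply: card_toggles => j.
  by rewrite ltn_mod.
have leK : #|M| <= K.
  by rewrite leq_min leM (leq_trans (subset_leq_card sM) (card_pairs n)).
suff [m mP EM] : exists2 m, m < NP &
    edges_of n (toggles (fun j => m %/ n ^ j %% n) K) = M.
  exists m => //; have gE : gr i m = symdiff (edges (G j)) M.
    by rewrite -ji gr_symdiff EM.
  by rewrite gE.
(* Without vertices [K] is 0 and [NP] is [0 ^ 0 = 1]: the single candidate 0 stands for the empty
   edit set. *)
have [n0|n0] := posnP n.
  exists 0; first by rewrite n0 muln0 minn0.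
  apply: eq_edges => // [|u]; first exact: edges_of_pairs.
  by have := ltn_ord u; rewrite [X in _ < X]n0.
have [dg dgn EM] := toggles_complete n0 sM leK.
have [j0 _|m mP Hm] := @digits_exist n (K + K) dg; first exact: dgn.
exists m => //; rewrite -EM; apply: eq_edges_of => u v _ _ _.
by apply: toggles_ext => j' /Hm.
Qed.

Record ready (h : mach) : Prop := Ready {
  rd_n : rv h n_ = n;
  rd_n2 : rv h n2_ = n + n;
  rd_l : rv h l_ = l;
  rd_d : rv h d_ = d;
  rd_nn : rv h nn_ = n * n;
  rd_kk : rv h kk_ = K;
  rd_k2 : rv h k2_ = K + K;
  rd_P : rv h P_ = NP;
  rd_rows : rows n h }.

Lemma ready_frame R A h h' : frame R A h h' ->
  ~~ has (mem R) [:: n_; n2_; l_; d_; nn_; kk_; k2_; P_] -> ROW \notin A ->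
  ready h -> ready h'.
Proof.
move=> [fR fA] /hasPn nR nA [H1 H2 H3 H4 H5 H6 H7 H8 H9].
split; rewrite ?fR //; try by apply: nR.
by move=> u un; rewrite fA ?H9.
Qed.

Definition entry (L : nat -> nat) base e : nat -> nat := fun u => L (base + e * n + u).

Definition accepted (h : mach) i m : Prop :=
  cluster_graph (gr i m) /\
  exists2 e, e < rv h cnt_ & compatible (rv h dd_)
    (clusters n (entry (av h LST) (rv h lo_) e)) (gr i m).

Definition previous_ok (h : mach) : Prop := rv h cnt_ <= NP /\
  forall e u, e < rv h cnt_ -> u < n -> entry (av h LST) (rv h lo_) e u < n.

Lemma run_candidate h i m : ready h -> i < l -> rv h off_ = i * (n * n) ->
  digits n m h -> previous_ok h ->
  let h' := run p_candidate h in
  digits n m.+1 h' /\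
  ((accepted h i m /\ exists F, [/\ forall u, u < n -> F u < n,
      gr i m = clusters n F,
      forall x, av h' LST x = if rv h hi_ <= x < rv h hi_ + n
        then F (x - rv h hi_) else av h LST x,
      rv h' hi_ = rv h hi_ + n & rv h' new_ = (rv h new_).+1]) \/
   (~ accepted h i m /\ [/\ forall x, av h' LST x = av h LST x,
      rv h' hi_ = rv h hi_ & rv h' new_ = rv h new_])).
Proof.
move=> rdy lti off dig [cntP entP] h'; rewrite {}/h' /p_candidate.
rewrite run_seq; set h1 := run _ h.
have [fR1 fA1] : frame _ _ h h1 := frame_run inp p_load h.
have rdy1 : ready h1 by apply: (ready_frame (frame_run inp p_load h)).
have adj1 : adjacency n (layer i) h1.
  apply: run_load => [|u v un vn]; first exact: rd_nn rdy.
  have := inpE (Ordinal lti) (Ordinal un) (Ordinal vn); rewrite /layer off /= => ->.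
  by case: (_ \in _).
rewrite run_seq; set h2 := run _ h1.
have [fR2 fA2] : frame _ _ h1 h2 := frame_run inp p_toggle h1.
have rdy2 : ready h2 by apply: (ready_frame (frame_run inp p_toggle h1)).
have dig1 j : j < K + K -> av h1 DIG j = m %/ n ^ j %% n.
  by move=> jK; rewrite fA1 // dig // (rd_k2 rdy).
have adj2 : adjacency n (candidate i m) h2.
  have dn j : j < rv h1 kk_ + rv h1 kk_ -> av h1 DIG j < n.
    rewrite (rd_kk rdy1) => jK; rewrite dig1 //.
    by case: (n) jK => [|n'] jK; rewrite ?ltn_mod //; move: jK; rewrite muln0 minn0.
  move=> u v un vn; rewrite (@run_toggle inp n h1 _ (rd_rows rdy1) dn adj1) //.
  rewrite (rd_kk rdy1) /candidate; congr (nat_of_bool (_ (+) _)).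
  exact: (toggles_ext dig1).
rewrite run_seq; set h3 := run _ h2.
have [fR3 fA3] : frame _ _ h2 h3 := frame_run inp p_labels h2.
have rdy3 : ready h3 by apply: (ready_frame (frame_run inp p_labels h2)).
have lab := @run_labels inp n h2 _ (rd_n rdy2) (rd_rows rdy2) adj2; rewrite -/h3 /= in lab.
have adj3 : adjacency n (candidate i m) h3 by move=> u v un vn; rewrite fA3 ?adj2.
rewrite run_seq; set h4 := run _ h3.
have [fR4 fA4] : frame _ _ h3 h4 := frame_run inp p_check h3.
have rdy4 : ready h4 by apply: (ready_frame (frame_run inp p_check h3)).
have good := @run_check inp n h3 _ (rd_n rdy3) (rd_rows rdy3) adj3; rewrite -/h4 in good.
have goodP : rv h4 good_ != 0 <-> cluster_graph (gr i m).
  by apply: (iff_trans good); apply: iff_sym; apply: min_labels lab; apply: sym_candidate.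
have goodE : rv h4 good_ != 0 -> gr i m = clusters n (av h4 LAB).
  by move/good=> H; rewrite fA4 //; apply: eq_edges_of.
have labn u : u < n -> av h4 LAB u < n by rewrite fA4 // => /lab[].
have E x : x \in [:: cnt_; dd_; lo_; hi_; new_; k2_] -> rv h4 x = rv h x.
  by move=> xs; rewrite fR4 ?fR3 ?fR2 ?fR1 //; move: x xs; apply/allP.
have EL : av h4 LST = av h LST by rewrite fA4 // fA3 // fA2 // fA1.
have dig4 : digits n m h4.
  by move=> j; rewrite E // fA4 // fA3 // fA2 // fA1 //; apply: dig.
rewrite run_seq; set h5 := run (CIf _ _ _) h4; set h6 := run _ h5.
have [fR5 fA5] : frame _ _ h4 h5 := frame_run inp _ h4.
have rdy5 : ready h5.
  pose c := CIf good_ (p_previous;; CIf ok_ p_append CSkip) CSkip.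
  exact: (ready_frame (frame_run inp c h4)).
have [fR6 fA6] : frame _ _ h5 h6 := frame_run inp p_next h5.
split.
  have [n0|n0] := posnP n.
    by move=> j; rewrite fR6 // (rd_k2 rdy5) n0 muln0 minn0.
  by apply: run_next (rd_n rdy5) _ => // j; rewrite fR5 // fA5 //; apply: dig4.
rewrite (fA6 LST) // (fR6 hi_) // (fR6 new_) //.
have [gd|/negPn/eqP bad] := boolP (rv h4 good_ != 0); last first.
  right; rewrite /h5 run_ifF // !E // EL; split=> // -[].
  by move/goodP; rewrite bad.
rewrite /h5 run_ifT // run_seq; set h7 := run _ h4.
have [fR7 fA7] : frame _ _ h4 h7 := frame_run inp p_previous h4.
have := @run_previous inp n h4 (rd_n rdy4) (rd_n2 rdy4).
rewrite (rd_P rdy4) !E // EL -/h7 => /(_ cntP labn entP) okP.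
have accP : rv h7 ok_ != 0 <-> accepted h i m.
  apply: (iff_trans okP); rewrite /accepted (goodE gd); split=> [H|[]//].
  by split=> //; rewrite -(goodE gd); apply/goodP.
have [ok|/negPn/eqP nok] := boolP (rv h7 ok_ != 0); last first.
  right; rewrite run_ifF // fA7 // EL !fR7 // !E //; split=> //.
  by move/accP; rewrite nok.
left; split; first exact/accP.
exists (av h4 LAB); rewrite run_ifT //.
have [|A1 A2 A3] := @run_append inp n h7; first by rewrite fR7 ?(rd_n rdy4).
split=> //; first exact: goodE.
- by move=> x; rewrite A1 !fR7 // !E // !fA7 // EL.
- by rewrite A2 fR7 // E.
- by rewrite A3 fR7 // E.
Qed.

(** Entries may repeat, as several sequences can give the same cluster graph; only the set of graphs
    is pinned down. *)
Definition listed i base cnt (L : nat -> nat) : Prop :=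
  [/\ forall e u, e < cnt -> u < n -> entry L base e u < n,
      forall e, e < cnt -> reach G k d i (clusters n (entry L base e)) &
      forall E, reach G k d i E -> exists2 e, e < cnt & E = clusters n (entry L base e)].

Definition layer_state i (h : mach) : Prop :=
  [/\ ready h, digits n 0 h,
      [/\ rv h off_ = i * (n * n), rv h dd_ = threshold n d i, rv h cnt_ <= NP &
         rv h hi_ = rv h lo_ + rv h cnt_ * n] &
      listed i (rv h lo_) (rv h cnt_) (av h LST)].

Lemma entry_below base e u cnt : e < cnt -> u < n -> base + e * n + u < base + cnt * n.
Proof.
move=> ec un; rewrite -addnA ltn_add2l.
apply: (@leq_trans (e.+1 * n)); first by rewrite mulSnr ltn_add2l.
by rewrite leq_mul2r ec orbT.
Qed.

Lemma eq_clusters f g : (forall u, u < n -> f u = g u) -> clusters n f = clusters n g.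
Proof. by move=> fg; apply: eq_edges_of => u v un vn _; rewrite !fg. Qed.

Lemma run_layer i h : i < l -> layer_state i h -> layer_state i.+1 (run p_layer h).
Proof.
move=> lti [rdy dig [off dd cntP hiE] [entP sound complete]].
rewrite /p_layer run_seq run_seq; set h2 := run _ (run _ h).
rewrite run_seq; set h3 := run _ h2.
have [fR3 fA3] : frame _ _ h2 h3 := frame_run inp _ h2.
have rdy2 : ready h2 by case: rdy.
have h3n : rv h3 n_ = n by rewrite fR3 // (rd_n rdy2).
pose acc m := accepted h i m.
(* New entries begin at the old [hi_] and everything below is preserved, so acceptance can be judged
   in the initial state [h]. The clause [new_ <= m] gives the bound [NP] on the next list. *)
pose J m g := [/\ digits n m g, rv g new_ <= m, rv g hi_ = rv h hi_ + rv g new_ * n,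
  forall x, x < rv h hi_ -> av g LST x = av h LST x &
  [/\ forall e u, e < rv g new_ -> u < n -> entry (av g LST) (rv h hi_) e u < n,
      forall e, e < rv g new_ -> exists2 m', m' < NP /\ acc m' &
        clusters n (entry (av g LST) (rv h hi_) e) = gr i m' &
      forall m', m' < m -> acc m' -> exists2 e, e < rv g new_ &
        clusters n (entry (av g LST) (rv h hi_) e) = gr i m']].
have Jend : J NP h3.
  rewrite -(rd_P rdy2); apply: (@run_for inp J) => //.
    by split=> //; rewrite /= ?addn0.
  move=> m g gF; rewrite (rd_P rdy2) => lt_m gm [J1 J2 J3 J4 [J5 J6 J7]].
  have [fR fA] := gF; have rdyg : ready g by apply: (ready_frame gF).
  have [Eoff Ecnt Edd Elo] : [/\ rv g off_ = rv h off_, rv g cnt_ = rv h cnt_,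
      rv g dd_ = rv h dd_ & rv g lo_ = rv h lo_] by split; rewrite fR.
  have entE e : e < rv h cnt_ -> forall u, u < n ->
      entry (av g LST) (rv h lo_) e u = entry (av h LST) (rv h lo_) e u.
    by move=> ec u un; rewrite /entry J4 // hiE entry_below.
  have prev : previous_ok g.
    split; rewrite Ecnt // Elo => e u ec un; rewrite entE //; exact: entP.
  have accE : accepted g i m <-> acc m.
    rewrite /acc /accepted Ecnt Edd Elo; split=> -[cE [e ec cmp]]; split=> //; exists e => //.
      by rewrite (eq_clusters (entE e ec)) in cmp.
    by rewrite (eq_clusters (entE e ec)).
  have [|H1 H2] := run_candidate rdyg lti _ J1 prev; first by rewrite Eoff.
  set g1 := run p_candidate g in H1 H2 *.
  case: H2 => [[/accE am [F [Fn gF' L1 hi1 new1]]]|[nacc [L1 hi1 new1]]]; last first.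
    rewrite /J /= hi1 new1; split=> //; first exact: leqW.
      by move=> x xh; rewrite L1 J4.
    have eqL e : clusters n (entry (av g1 LST) (rv h hi_) e) =
        clusters n (entry (av g LST) (rv h hi_) e).
      by apply: eq_clusters => u un; rewrite /entry L1.
    split=> [e u en un|e|m']; first by rewrite /entry L1; apply: J5.
      by rewrite eqL; apply: J6.
    rewrite ltnS leq_eqVlt => /orP[/eqP->|lt] am.
      by case: nacc; apply/accE.
    by have [e en eE] := J7 _ lt am; exists e; rewrite ?eqL.
  have old e u : e < rv g new_ -> u < n ->
      entry (av g1 LST) (rv h hi_) e u = entry (av g LST) (rv h hi_) e u.
    move=> en un; rewrite /entry L1 J3 ifF //; apply/negP => /andP[].
    by rewrite leqNgt entry_below.
  have new u : u < n -> entry (av g1 LST) (rv h hi_) (rv g new_) u = F u.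
    move=> un; rewrite /entry L1 J3 ifT; last by rewrite leq_addr ltn_add2l.
    by rewrite addKn.
  rewrite /J /= hi1 new1; split=> //.
  - by rewrite J3 mulSnr addnA.
  - by move=> x xh; rewrite L1 J3 ifF ?J4 //; apply/negP => /andP[]; lia.
  split.
  - move=> e u; rewrite ltnS leq_eqVlt => /orP[/eqP->|en] un.
      by rewrite new ?Fn.
    by rewrite old //; apply: J5.
  - move=> e; rewrite ltnS leq_eqVlt => /orP[/eqP->|en].
      by exists m => //; rewrite (eq_clusters new).
    have [m' ? ?] := J6 _ en; exists m' => //.
    by rewrite (eq_clusters (fun u => old e u en)).
  - move=> m'; rewrite ltnS leq_eqVlt => /orP[/eqP->|lt] am'.
      by exists (rv g new_) => //; rewrite (eq_clusters new).
    have [e en eE] := J7 _ lt am'; exists e; first exact: leqW.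
    by rewrite (eq_clusters (fun u => old e u en)).
have [J1 J2 J3 J4 [J5 J6 J7]] := Jend.
have rdy3 : ready h3 by apply: (ready_frame (frame_run inp (CFor m_ P_ p_candidate) h2)).
have h3st : rv h3 st_ = rv h hi_ by rewrite fR3.
have h3off : rv h3 off_ = i * (n * n) by rewrite fR3.
clearbody h3; set h4 := run _ h3.
have h4E : h4 = setr (setr (setr (setr h3 lo_ (rv h hi_)) cnt_ (rv h3 new_))
    off_ (i.+1 * (n * n))) dd_ d.
  by rewrite /h4 /= h3st h3off (rd_nn rdy3) (rd_d rdy3) mulSnr.
clearbody h4; rewrite {}h4E; split.
- by case: rdy3.
(* For [j < K + K] the number [NP] is a multiple of [n ^ j.+1], so all digits are zero again. *)
- move=> j /= jk; rewrite J1 // div0n mod0n.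
  have jK : j < K + K by rewrite -(rd_k2 rdy3).
  have n0 : 0 < n by case: (n) jK => //; rewrite muln0 minn0.
  by rewrite -(subnK (ltnW jK)) expnD mulnK ?expn_gt0 ?n0 // -(subnSK jK) expnS modnMr.
- by split=> //=.
split=> //= [e /J6[m' [m'P acc'] ->]|E].
  split; first by apply/layer_clusteringP => //; exists m' => //; case: acc'.
  case: acc' => _ [e' e'c cmp]; exists (clusters n (entry (av h LST) (rv h lo_) e')).
    exact: sound.
  by rewrite -dd.
case=> /(layer_clusteringP _ lti)[m' m'P [cE ->]] [E' rE' cmp].
have [e' e'c E'E] := complete _ rE'.
have am : acc m' by split=> //; exists e' => //; rewrite -E'E dd.
by have [e en eE] := J7 _ m'P am; exists e.
Qed.

Lemma run_main h : ready h -> digits n 0 h -> rv h off_ = 0 -> rv h lo_ = 0 ->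
  (forall x, av h LST x = 0) ->
  rv (run p_main h) n_ != 0 <-> TCE G k d.
Proof.
move=> rdy dig off lo L0; rewrite /p_main run_seq; set h1 := run _ h.
have [S2 S3 S4] : [/\ rv h1 hi_ = n, rv h1 cnt_ = 1 & rv h1 dd_ = n].
  by rewrite /= (rd_n rdy).
have [fR1 fA1] : frame _ _ h h1 := frame_run inp p_setup h.
have rdy1 : ready h1.
  by apply: (ready_frame (frame_run inp p_setup h)).
have st1 : layer_state 0 h1.
  split=> //.
    rewrite S2 S3 S4 !fR1 // off lo mul0n add0n mul1n; split=> //.
    by case: (n) => [|n']; rewrite ?muln0 ?minn0 // expn_gt0.
  rewrite S3 fR1 // lo fA1 //.
  have E0 e : entry (av h LST) 0 e =1 fun=> 0 by move=> u; rewrite /entry L0.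
  have c0 : clusters n (entry (av h LST) 0 0) = clusters n (fun=> 0).
    by apply: eq_clusters => u _; apply: E0.
  split=> [e u _ un|[|e] // _|E ->]; first by rewrite E0; apply: leq_ltn_trans un.
  by exists 0.
rewrite run_seq; set h2 := run _ h1.
have keep i g v : layer_state i g -> layer_state i (setr g i_ v).
  by case=> rdy' ? ? ?; split=> //; case: rdy'.
have : layer_state l h2.
  rewrite -(rd_l rdy1); apply: (@run_for inp layer_state) => //; first exact: keep.
  move=> i g gF; rewrite (rd_l rdy1) => lti gi st; apply: keep; exact: run_layer.
case=> _ _ _ [_ sound complete]; rewrite [rv _ n_]/=.
apply: (iff_trans _ (iff_sym (TCE_reach G k d))).
split=> [|[E /complete[e]]]; last by case: (rv h2 cnt_).
by rewrite -lt0n => c0; exists (clusters n (entry (av h2 LST) (rv h2 lo_) 0)); apply: sound.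
Qed.

End Solve.

(** * Running time *)

(** The constants here and below are round upper bounds for the sums that [time_bound] unfolds to;
    lower order terms are absorbed by the leading one. *)
Lemma time_compatible h n : 0 < n -> rv h n_ = n -> rv h n2_ = n + n ->
  time_bound p_compatible h <= 2200 * (n * n).
Proof.
move=> n0 hn hn2; rewrite /= hn hn2.
have : n <= n * n by rewrite leq_pmulr.
have : 0 < n * n by rewrite muln_gt0 n0.
lia.
Qed.

(** By the cap on [kk_], preparing a candidate costs O(n^2), like a single compatibility test, and
    the [P_] tests dominate. *)
Lemma time_candidate h n : 0 < n -> rv h n_ = n -> rv h n2_ = n + n ->
  rv h nn_ = n * n -> rv h kk_ <= n * n -> rv h k2_ = rv h kk_ + rv h kk_ ->
  0 < rv h P_ -> time_bound p_candidate h <= 3000 * (rv h P_ * (n * n)).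
Proof.
move=> n0 hn hn2 hnn hkk hk2 P0.
rewrite /p_candidate /p_previous /time_bound -/time_bound.
have := time_compatible n0 hn hn2; set X := time_bound p_compatible h => XE.
rewrite /= hn hnn hk2; move: (rv h kk_) (rv h P_) hkk P0 => kk P hkk P0.
have : P * X <= P * (2200 * (n * n)) by rewrite leq_mul2l XE orbT.
have : n <= n * n by rewrite leq_pmulr.
have : 0 < n * n by rewrite muln_gt0 n0.
move=> N0 nN PX.
have : P <= P * (n * n) by rewrite leq_pmulr.
have : n * n <= P * (n * n) by rewrite leq_pmull.
lia.
Qed.

Lemma time_main h n : 0 < n -> rv h n_ = n -> rv h n2_ = n + n ->
  rv h nn_ = n * n -> rv h kk_ <= n * n -> rv h k2_ = rv h kk_ + rv h kk_ ->
  0 < rv h P_ -> 0 < rv h l_ ->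
  time_bound p_main h <= 3100 * (rv h l_ * (rv h P_ * (rv h P_ * (n * n)))).
Proof.
move=> n0 hn hn2 hnn hkk hk2 P0 l0.
have := time_candidate n0 hn hn2 hnn hkk hk2 P0.
rewrite /p_main /p_layer /time_bound -/time_bound.
set X := time_bound p_candidate h; rewrite /= => XE.
move: (rv h l_) (rv h P_) l0 P0 XE => l P l0 P0 XE.
have N0 : 0 < n * n by rewrite muln_gt0 n0.
move: (n * n) N0 XE => N N0 XE.
have Q0 : 0 < P * N by rewrite muln_gt0 P0.
move: (P * N) Q0 XE => Q Q0 XE.
have : l * (P * X) <= l * (P * (3000 * Q)) by rewrite !leq_mul2l XE !orbT.
have PQ : P <= P * Q by rewrite leq_pmulr.
have : l * P <= l * (P * Q) by rewrite leq_mul2l PQ orbT.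
have : l <= l * (P * Q) by rewrite leq_pmulr // muln_gt0 P0.
lia.
Qed.

Lemma time_size h n : rv h n_ = n -> time_bound p_size h <= 41 * n.+1.
Proof. by move=> hn; rewrite /= hn; lia. Qed.

Lemma time_tables h n K : rv h n_ = n -> rv h k2_ = K ->
  time_bound (p_rows;; p_count) h <= 85 * (K * n + K + n + 1).
Proof. by move=> hn hK; rewrite /= hn hK; lia. Qed.

(** Machine code by hand: the loop language keeps its arrays behind the input, whose length has yet
    to be computed. *)
Definition add_times acc x cnt one : prog :=
  While cnt (Seq (Add acc acc x) (Defs.Sub cnt cnt one)).

Lemma exec_add_times acc x cnt one s :
  uniq [:: acc; x; cnt; one] -> reg s one = 1 ->
  exists2 s', exec (add_times acc x cnt one) s (3 * reg s cnt + 1) s' &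
    [/\ cells s' = cells s, reg s' acc = reg s acc + reg s cnt * reg s x,
        reg s' cnt = 0 &
        forall y, y != acc -> y != cnt -> reg s' y = reg s y].
Proof.
rewrite /= !inE !negb_or andbT => /and3P[/and3P[ax ac ao] /andP[xc xo] co] s1.
move E: (reg s cnt) => c; elim: c s s1 E => [|c IH] s s1 E.
  by exists s; rewrite ?addn0 //; apply: exec_while_end.
set s2 := set_reg s acc (reg s acc + reg s x).
set s3 := set_reg s2 cnt (reg s2 cnt - reg s2 one).
have [||s' E' [M1 R1 R2 R3]] := IH s3.
- by rewrite /= /upd (eq_sym one) (negPf co) (eq_sym one) (negPf ao).
- rewrite /= /upd eqxx (eq_sym cnt) (negPf ac) (eq_sym one) (negPf ao) E s1.
  by rewrite subn1.
exists s'.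
  rewrite (_ : 3 * c.+1 + 1 = (1 + 1 + (3 * c + 1)).+1); last by lia.
  apply: exec_while_loop E'; first by rewrite E.
  by apply: exec_seq; constructor.
split=> // [|y ya yc].
  rewrite R1 /= /upd (negPf ac) eqxx (negPf xc) (eq_sym x) (negPf ax) mulSn.
  by rewrite addnA.
by rewrite R3 // /= /upd (negPf yc) (negPf ya).
Qed.

(* Leaves the length [l * n * n] of the input in register [base_]. *)
Definition p_base : prog :=
  Seq (Const 36 1) (Seq (Add 37 n_ 38) (Seq (add_times 39 n_ 37 36)
    (Seq (Add 37 l_ 38) (add_times base_ 39 37 36)))).

(** The blocks are compiled separately, because later loops are bounded by registers such as [k2_]
    and [P_] that earlier blocks compute, which [wf_cmd] forbids within one command. *)
Definition tce_program : prog :=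
  Seq p_base (Seq (ccmd base_ p_size)
    (Seq (ccmd base_ (p_rows;; p_count)) (ccmd base_ p_main))).

Section Input.
Variables (n l k d : nat) (G : temporal_graph 'I_n l).
Local Notation inp := (cells (tce_input G k d)).

Lemma inputE (i : 'I_l) (u v : 'I_n) :
  inp (i * (n * n) + (u * n + v)) = ([set u; v] \in edges (G i)).
Proof.
rewrite /= mulnA addnA -mulnDl; congr nat_of_bool; apply/existsP/idP => [|H]; last first.
  by exists i; apply/existsP; exists u; apply/existsP; exists v; rewrite eqxx.
case=> i' /existsP[u' /existsP[v']]; rewrite !row_major_inj //.
by case/andP=> /andP[/andP[/eqP/val_inj-> /eqP/val_inj->] /eqP/val_inj->].
Qed.

Lemma input_end a : l * (n * n) <= a -> inp a = 0.
Proof.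
move=> le; rewrite /=; case: existsP => // -[i /existsP[u /existsP[v /andP[/eqP E _]]]].
have : i * n + u < l * n.
  apply: (@leq_trans (i.+1 * n)); first by rewrite mulSnr ltn_add2l.
  by rewrite leq_mul2r ltn_ord orbT.
have : v < n by [].
move: (i * n + u) E => x E vn xl.
suff : a < l * n * n by rewrite -mulnA ltnNge le.
rewrite E; apply: (@leq_trans (x.+1 * n)); first by rewrite mulSnr ltn_add2l.
by rewrite leq_mul2r xl orbT.
Qed.

Definition start := Mach (nth 0 [:: n; l; k; d]) (fun _ _ => 0).

Lemma exec_base : exists2 s,
  exec p_base (tce_input G k d) (3 * n + 3 * l + 5) s & rep base_ inp s start.
Proof.
set s0 := tce_input G k d.
(* Register 38 is never written and holds 0, so adding it copies a register. *)
pose s1 := set_reg s0 36 1; pose s2 := set_reg s1 37 (reg s1 n_ + reg s1 38).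
have [//|//|s3 E3 [M3 A3 C3 R3]] := @exec_add_times 39 n_ 37 36 s2.
pose s4 := set_reg s3 37 (reg s3 l_ + reg s3 38).
have [//||s5 E5 [M5 A5 C5 R5]] := @exec_add_times base_ 39 37 36 s4.
  by rewrite /= /upd /= R3.
have c2 : reg s2 37 = n by rewrite /= /upd /= addn0.
have c4 : reg s4 37 = l by rewrite /= /upd /= !R3 //= addn0.
have r39 : reg s4 39 = n * n by rewrite /= /upd /= A3 c2.
have r5 : reg s5 base_ = l * (n * n) by rewrite A5 c4 r39 /= /upd /= R3.
exists s5.
  rewrite (_ : _ + 5 = 1 + (1 + ((3 * n + 1) + (1 + (3 * l + 1))))); last by lia.
  apply: exec_seq; first by constructor.
  apply: exec_seq; first by constructor.
  rewrite -{1}c2; apply: exec_seq E3 _.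
  by rewrite -c4; apply: exec_seq E5; constructor.
split=> //.
- move=> x xB; rewrite R5 /= ?ltn_eqF //; last exact: ltn_trans xB _.
  rewrite /upd ltn_eqF ?(ltn_trans xB) // R3 ?ltn_eqF ?(ltn_trans xB) //.
  by rewrite /= /upd !ltn_eqF ?(ltn_trans xB).
- by move=> a; rewrite M5 /= M3; left.
- by move=> a; rewrite r5; apply: input_end.
- by move=> a i _; rewrite M5 /= M3 r5; apply: input_end; apply: leq_addr.
Qed.

End Input.

Theorem theorem2 :
  exists (p : prog) (C : nat),
    forall (n l k d : nat) (G : temporal_graph 'I_n l),
      exists (t : nat) (s : state),
        [/\ exec p (tce_input G k d) t s,
            accepting s <-> TCE G k d
          & 2 <= n -> 1 <= l ->
            t <= C * (l * n ^ (4 * k + 2) * trunc_log 2 n)].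
Proof.
exists tce_program, 4000 => n l k d G.
pose inp := cells (tce_input G k d).
pose h0 := start n l k d; pose h1 := run inp p_size h0.
pose h2 := run inp (p_rows;; p_count) h1.
have [s0 E0 R0] := exec_base k d G.
have [s1 [t1 [E1 T1 _ R1]]] := exec_ccmd R0 (erefl : wf_cmd base_ p_size).
have [s2 [t2 [E2 T2 _ R2]]] := exec_ccmd R1 (erefl : wf_cmd base_ (p_rows;; p_count)).
have [s3 [t3 [E3 T3 _ R3]]] := exec_ccmd R2 (erefl : wf_cmd base_ p_main).
rewrite -/inp -/h0 -/h1 -/h2 in R1 R2 R3 T1 T2 T3.
have [A1 A2 A3 A4] := @run_size inp h0 n k erefl erefl.
rewrite -/h1 in A1 A2 A3 A4.
have [fR1 fA1] : frame _ _ h0 h1 := frame_run inp p_size h0.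
pose g := run inp p_rows h1.
have [fRg fAg] : frame _ _ h1 g := frame_run inp p_rows h1.
have [fRc fAc] : frame _ _ g h2 := frame_run inp p_count g.
have [fR2 fA2] : frame _ _ h1 h2 := frame_run inp (p_rows;; p_count) h1.
have hP : rv h2 P_ = n ^ (minn k (n * n) + minn k (n * n)).
  by rewrite (@run_count inp g n) ?fRg ?A4 // fR1.
have rdy : ready n l k d h2.
  split=> //; [by rewrite fR2 // fR1 | by rewrite fR2 | by rewrite fR2 // fR1
    | by rewrite fR2 // fR1 | by rewrite fR2 | by rewrite fR2 | by rewrite fR2 |].
  by move=> u un; rewrite fAc // (@run_rows inp n h1) // fR1.
exists (3 * n + 3 * l + 5 + (t1 + (t2 + t3))), s3; split.
- by apply: exec_seq E0 _; apply: exec_seq E1 _; apply: exec_seq E2 E3.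
- case: R3 => R3 _ _ _; rewrite /accepting R3 //.
  apply: (run_main (@inputE n l k d G)) rdy _ _ _ _.
  + by move=> j; rewrite fA2 // fA1 // div0n mod0n.
  + by rewrite fR2 // fR1.
  + by rewrite fR2 // fR1.
  + by move=> x; rewrite fA2 // fA1.
move=> n2 l1.
have n0 : 0 < n by apply: ltnW.
set K := minn k (n * n) in A3 A4 hP; pose P := n ^ (K + K).
have P0 : 0 < P by rewrite expn_gt0 n0.
(* This absorbs the cost of the tables, which is of order [K * n]. *)
have KP : K <= P by rewrite /P expnD; apply: leq_trans (ltnW (ltn_expl K n2)) _;
  rewrite leq_pmulr // expn_gt0 n0.
have := time_main n0 (rd_n rdy) (rd_n2 rdy) (rd_nn rdy).
rewrite (rd_kk rdy) (rd_k2 rdy) (rd_P rdy) (rd_l rdy) -/K -/P => /(_ (geq_minr _ _) erefl P0 l1).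
move/(leq_trans T3) => {}T3.
have {}T1 := leq_trans T1 (time_size (erefl : rv h0 n_ = n)).
have h1n : rv h1 n_ = n by rewrite fR1.
have {}T2 := leq_trans T2 (time_tables h1n A4).
have N0 : 0 < n * n by rewrite muln_gt0 n0.
have nN : n <= n * n by rewrite leq_pmulr.
set W := l * (P * (P * (n * n))) in T3.
have KnPN : K * n <= P * (n * n) by rewrite leq_mul.
have PNPPN : P * (n * n) <= P * (P * (n * n)) by rewrite leq_pmull.
have PPNW : P * (P * (n * n)) <= W by rewrite leq_pmull.
have lW : l <= W by rewrite leq_pmulr // !muln_gt0 P0 n0.
have PPN : P <= P * (n * n) by rewrite leq_pmulr.
have NPN : n * n <= P * (n * n) by rewrite leq_pmull.
(* Two factors [n ^ (K + K)] with [K <= k] account for [4 * k], the cost [n * n] of a test for the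
   remaining 2. *)
have WE : W <= l * n ^ (4 * k + 2).
  rewrite leq_mul2l mulnA expnD; apply/orP; right; apply: leq_mul => //.
  rewrite -expnD leq_exp2l //.
  by have := geq_minl k (n * n); rewrite -/K; lia.
have log0 : 0 < trunc_log 2 n by rewrite trunc_log_gt0.
(* The main loop takes at most [3100 * W], and each summand of the preparations is at most a
   constant times [W]. The logarithm is at least 1. *)
apply: (@leq_trans (4000 * W)).
  move: (W) (P * (P * (n * n))) (P * (n * n)) (n * n) => W' X Y Z in lW PPNW T3
    PNPPN KnPN PPN NPN nN N0 *; lia.
rewrite leq_mul2l; apply/orP; right; apply: leq_trans WE _.
by rewrite leq_pmulr.
Qed.
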